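(* Let $\mathcal B^c=(\mathcal B,\mathcal H)$ be the collared Bratteli diagram associated with a proper nested sequence of tilings $(T_n)_{n\in\mathbb N}$ of $\mathbb R^d$. Then the equivalence relation $R_{\mathcal B}=\{(x,y)\in\partial\mathcal B\times\partial\mathcal B: x\sim y\}$ is étale.
   Context: **Tilings.** A tile is a compact subset of $\mathbb R^d$ equal to the closure of its interior; every tile is punctured (comes with a distinguished point of it, its puncture) and may carry a label; equality and translation of tiles respect punctures and labels. A patch is a finite set of tiles with pairwise disjoint interiors, whose union is its support; a tiling is a countable set of tiles with pairwise disjoint interiors and union $\mathbb R^d$. Tiles have finite CW-complex structures, and the intersection of two tiles of a tiling is a subcomplex of both. The inner (outer) radius of a tile or patch is the radius of the largest (smallest) ball centered at its puncture contained in (containing) its support. $T$ has FLC if for each $\rho>0$ there are finitely many patches of $T$ of outer radius $<\rho$ up to translation; it is repetitive if for each patch $p\subset T$ there is $\rho_p>0$ such that for every $x\in\mathbb R^d$ some translate of $p$ is a set of tiles of $T$ contained in $B(x,\rho_p)$; it is aperiodic if $T+a\ne T$ for all $a\neq0$. **Hull.** For tilings $T,T'$ let $\delta(T,T')=\min(\inf A,1)$, where $A$ is the set of $\varepsilon\in(0,1)$ for which there are $a,a'\in B(0,\varepsilon)$ such that $T+a$ and $T'+a'$ have the same tiles with puncture in $B(0,1/\varepsilon)$. The tiling space $\Omega$ of $T_1$ is the closure of $\{T_1+a: a\in\mathbb R^d\}$, and the canonical transversal $\Xi\subset\Omega$ is the subset of tilings having a tile with puncture at $0$. For a patch $p$,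 $\Xi(p)=\{T'\in\Xi: p\subset T'\}$. **Proper nested sequences.** A nested sequence of tilings is a sequence $(T_n)_{n\ge1}$ of tilings such that for all $n\ge2$ the tiles of $T_n$ are (supports of) patches of $T_{n-1}$; one assumes (without loss of generality) that $T_1$ has a tile with puncture at $0$. The substitution map $\sigma_n$ ($n\ge2$) sends each tile of $T_n$ to the patch of $T_{n-1}$ of which it is the support (tiles of $T_n$ with the same shape but corresponding to different patches are labelled as different); it is extended to translates of tiles by $\sigma_n(t+a)=\sigma_n(t)+a$ and to patches by unions; $\sigma_1$ is the identity. Let $r_n>0$ be the minimum of the inner radii and $R_n$ the maximum of the outer radii of the tiles of $T_n$. The sequence is proper if every $T_n$ is aperiodic, repetitive and has FLC, and for all $n\ge2$: (i) for each tile $t_n\in T_n$, $\sigma_n(t_n)$ is a patch of $T_{n-1}$; (ii) for each tile $t_n\in T_n$, $\sigma_n(t_n)$ contains a tile of $T_{n-1}$ in the interior of its support; (iii) there is $\rho>0$ independent of $n$ with $r_n>r_{n-1}+\rho$ and $R_n>R_{n-1}+\rho$. **Collars.** For $t\in T_n$, $\mathrm{Col}(t)=\{t'\in T_n:\mathrm{dist}(t,t')\le r_n\}$. A collared prototile of $T_n$ is a class of tiles of $T_n$ that agree, together with their collars, up to translation. There are finitely many; let $t^{(n)}_i$, $i=1,\dots,p_n$, denote their representatives with puncture at $0$ (a collared tile remembers its collar). **Bratteli diagram $\mathcal B=(\mathcal V,\mathcal E,r,s,u)$ of $(T_n)$.** $\mathcal V_0=\{\circ\}$, $\mathcal V_n=\{t^{(n)}_i\}_i$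 for $n\ge1$; $\mathcal E_1$ has one edge from $\circ$ to each vertex of $\mathcal V_1$, with label $u=0$; for $n\ge2$, $\mathcal E_n$ has one edge $e$ with $s(e)=t^{(n-1)}_i$, $r(e)=t^{(n)}_j$ for each $a\in\mathbb R^d$ such that the collared tile $t^{(n-1)}_i+a$ is a tile of the patch $\sigma_n(t^{(n)}_j)$, and its label is $u(e)=-a$. $\Pi_n$ is the set of paths $\gamma=(e_1,\dots,e_n)$ with $e_i\in\mathcal E_i$, $r(e_i)=s(e_{i+1})$; $r(\gamma)=r(e_n)$ and $u(\gamma)=\sum_i u(e_i)$. $\partial\mathcal B$ is the set of infinite paths, with the topology inherited from the product of the discrete sets $\mathcal E_n$; $x|_{\Pi_n}$ is the prefix of length $n$ of $x$. For $\gamma\in\Pi_n$ with $r(\gamma)=t$, $p^c_\gamma=\sigma_1\circ\cdots\circ\sigma_n(\mathrm{Col}(t))+u(\gamma)$. There is a canonical homeomorphism $\varphi:\partial\mathcal B\to\Xi$, where $\varphi(x)$ is the unique element of $\bigcap_n\Xi(p^c_{x|_{\Pi_n}})$. Write $T_x=\varphi(x)$. **Horizontal structure.** $\mathcal H=\bigsqcup_n\mathcal H_n$, $r,s:\mathcal H_n\to\mathcal V_n$: there is an edge $h\in\mathcal H_n$ with $s(h)=t$, $r(h)=t'$ and label $u(h)=a'-a$ whenever there are $a,a'\in\mathbb R^d$ such that the collared tiles $t+a$, $t'+a'$ belong to $T_n$, with $t+a\in\mathrm{Col}(t'+a')$ and $t'+a'\in\mathrm{Col}(t+a)$ (one edge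 for each triple $(t,t',a'-a)$; trivial edges $t=t'$, $u=0$ allowed). **The relation $\sim$.** For $e,e'\in\mathcal E_n$, $h\in\mathcal H_{n-1}$, $h'\in\mathcal H_n$, one says $(h,e,e',h')$ is a commutative diagram if $s(h)=s(e)$, $r(h)=s(e')$, $r(e)=s(h')$, $r(e')=r(h')$ and $u(e)+u(h')=u(h)+u(e')$. For $x=(e_n)$, $y=(e'_n)$ in $\partial\mathcal B$, $x\sim y$ means: there are $n_0$ and $h_n\in\mathcal H_n$ for all $n\ge n_0$ such that $(h_{n-1},e_n,e'_n,h_n)$ is a commutative diagram for each $n>n_0$. If $x\sim y$ there is a (unique) vector $a(x,y)\in\mathbb R^d$ with $T_y=T_x+a(x,y)$. Topology of $R_{\mathcal B}$: $(x_n,y_n)\to(x,y)$ iff $x_n\to x$ in $\partial\mathcal B$ and $a(x_n,y_n)\to a(x,y)$ in $\mathbb R^d$. **Étale.** An equivalence relation $R$ (with a topology) on a compact metrizable space $X$ is étale if: (i) $R^2=\{((x,y),(y,z))\in R\times R\}$ is closed in $R\times R$ and the maps sending $((x,y),(y,z))\in R^2$ to $(x,y)$, $(y,z)$, $(x,z)$ in $R$ are continuous; (ii) the diagonal $\{(x,x):x\in X\}$ is open in $R$; (iii) the maps $r,s:R\to X$, $r(x,y)=x$, $s(x,y)=y$, are open and are local homeomorphisms. *)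

(* Defs.v *)
From HB Require Import structures.
From mathcomp Require Import all_boot all_order all_algebra.
From mathcomp Require Import all_classical all_reals all_analysis.

Set Implicit Arguments.
Unset Strict Implicit.
Unset Printing Implicit Defensive.

Import Order.TTheory GRing.Theory Num.Theory.
Import numFieldNormedType.Exports.

Local Open Scope classical_set_scope.
Local Open Scope ring_scope.

(* The norm of the library on ['rV[R]_k] is the sup norm, which has the same
   topology; radii and distances between tiles are Euclidean. *)
Definition enorm (R : realType) (k : nat) (v : 'rV[R]_k) : R :=
  Num.sqrt (\sum_(i < k) v ord0 i ^+ 2).

Section EuclideanSets.
Context {R : realType} {k : nat}.
Implicit Types (x : 'rV[R]_k) (A B : set 'rV[R]_k) (rho : R).

Definition eball x rho : set 'rV[R]_k := [set y | enorm (y - x) < rho].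

Definition eclosed_ball x rho : set 'rV[R]_k := [set y | enorm (y - x) <= rho].

Definition esphere x rho : set 'rV[R]_k := [set y | enorm (y - x) = rho].

Definition edist A B : R :=
  inf [set rho | exists x y, [/\ A x, B y & rho = enorm (y - x)]].

Definition inner_radius x A : R :=
  sup [set rho | 0 <= rho /\ eclosed_ball x rho `<=` A].

Definition outer_radius x A : R :=
  inf [set rho | 0 <= rho /\ A `<=` eclosed_ball x rho].

End EuclideanSets.

(* Finite CW structures on a subset of R^d, presented by characteristic maps
   [D^m -> R^d] (only their restriction to the closed unit ball matters).  For
   finitely many cells, closure finiteness and the weak topology are
   automatic. *)
Section CellComplexes.
Context {R : realType} {d : nat}.

Record cell := Cell {
  cell_dim : nat ;
  char_map : 'rV[R]_cell_dim -> 'rV[R]_d }.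

Arguments char_map : clear implicits.

Definition open_cell (c : cell) : set 'rV[R]_d := char_map c @` eball 0 1.

Record finite_cw_structure (C : set cell) (X : set 'rV[R]_d) : Prop := {
  cw_finite : finite_set C ;
  cw_continuous : forall c, C c ->
    {within eclosed_ball 0 1, continuous (char_map c)} ;
  cw_injective : forall c, C c ->
    {in eball 0 1 &, injective (char_map c)} ;
  cw_disjoint : trivIset C open_cell ;
  cw_cover : \bigcup_(c in C) open_cell c = X ;
  cw_boundary : forall c, C c ->
    char_map c @` esphere 0 1 `<=`
      \bigcup_(c' in [set c' | C c' /\ (cell_dim c' < cell_dim c)%N])
        open_cell c' }.

Definition subcomplex (C : set cell) (A : set 'rV[R]_d) : Prop :=
  closed A /\ exists2 C', C' `<=` C & A = \bigcup_(c in C') open_cell c.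

End CellComplexes.

Arguments cell : clear implicits.

Record tile (R : realType) (d : nat) (L : Type) := Tile {
  support : set 'rV[R]_d ;
  puncture : 'rV[R]_d ;
  label : L }.

Section Tilings.
Context {R : realType} {d : nat} {L : Type}.
Local Notation V := 'rV[R]_d.
Local Notation tile := (tile R d L).
Implicit Types (t : tile) (p q S T : set tile) (a x : V).

Definition is_tile t : Prop :=
  [/\ compact (support t), closure (interior (support t)) = support t
    & support t (puncture t)].

Definition tshift a t : tile :=
  Tile [set y + a | y in support t] (puncture t + a) (label t).

Definition pshift a p : set tile := [set tshift a t | t in p].

Definition psupport p : set V := \bigcup_(t in p) support t.

Definition patch p : Prop :=
  [/\ finite_set p, forall t, p t -> is_tile t
    & trivIset p (fun t => interior (support t))].

Definition patch_of T p : Prop := patch p /\ p `<=` T.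

Definition tiling T : Prop :=
  [/\ countable T, forall t, T t -> is_tile t,
      trivIset T (fun t => interior (support t)) & psupport T = setT].

Definition cellular T : Prop :=
  exists cw : tile -> set (cell R d),
    (forall t, T t -> finite_cw_structure (cw t) (support t)) /\
    (forall t t', T t -> T t' ->
       subcomplex (cw t) (support t `&` support t') /\
       subcomplex (cw t') (support t `&` support t')).

Definition tile_inner_radius t : R := inner_radius (puncture t) (support t).

Definition tile_outer_radius t : R := outer_radius (puncture t) (support t).

(* A patch is punctured at the puncture of one of its tiles. *)
Definition FLC T : Prop :=
  forall rho : R, 0 < rho ->
  exists2 F : set (set tile), finite_set F &
    forall p t, patch_of T p -> p t ->
      outer_radius (puncture t) (psupport p) < rho ->
      exists q a, F q /\ p = pshift a q.

Definition repetitive T : Prop :=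
  forall p, patch_of T p ->
  exists2 rho : R, 0 < rho &
    forall x, exists a,
      pshift a p `<=` T /\ psupport (pshift a p) `<=` eball x rho.

Definition aperiodic T : Prop := forall a, a != 0 -> pshift a T <> T.

(* [1] is added to the set because [inf set0 = 0] in the library, whereas the
   intended [min (inf A) 1] is [1] for empty [A]. *)
Definition tiling_dist T T' : R :=
  inf ([set eps | 0 < eps < 1 /\
         exists a a', [/\ eball 0 eps a, eball 0 eps a' &
           forall t, eball 0 eps^-1 (puncture t) ->
             (pshift a T t <-> pshift a' T' t)]] `|` [set 1]).

Definition hull T : set (set tile) :=
  [set T' | tiling T' /\
     forall eps : R, 0 < eps -> exists a, tiling_dist (pshift a T) T' < eps].

Definition transversal T : set (set tile) :=
  [set T' | hull T T' /\ exists2 t, T' t & puncture t = 0].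

Definition transversal_patch T p : set (set tile) :=
  [set T' | transversal T T' /\ p `<=` T'].

Definition min_inner_radius T : R := inf (tile_inner_radius @` T).

Definition max_outer_radius T : R := sup (tile_outer_radius @` T).

(* For [s] in [T] with support that of the patch [p] of [S], the substitution
   sends [tshift a s] to [pshift a p]; other tiles are sent to [set0]. *)
Definition subst S T t : set tile :=
  [set u | exists s a p, [/\ T s, t = tshift a s,
             patch_of S p, psupport p = support s & pshift a p u]].

Definition subst_patch S T p : set tile := \bigcup_(t in p) subst S T t.

Definition collar T t : set tile :=
  [set t' | T t' /\ edist (support t) (support t') <= min_inner_radius T].

Definition collared_tile := (tile * set tile)%type.

Definition cshift a (c : collared_tile) : collared_tile :=
  (tshift a c.1, pshift a c.2).

Definition collared T t : collared_tile := (t, collar T t).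

(* Since translation classes have a unique representative with puncture at
   [0], the collared prototiles are these representatives. *)
Definition prototiles T : set collared_tile :=
  [set cshift (- puncture t) (collared T t) | t in T].

(* The tiles of the patch obtained by substituting the collared tile [c], with
   their own collars. *)
Definition collared_subst S T (c : collared_tile) : set collared_tile :=
  [set u | exists s b v, [/\ T s, c = cshift b (collared T s), subst S T s v
             & u = cshift b (collared S v)]].

End Tilings.

Arguments collared_tile : clear implicits.

(* Levels are shifted by one with respect to the indexing (T_n), n >= 1: here and
   below, [T n] stands for T_{n+1}, and [T 0] is the tiling whose hull is
   considered. *)
Record nested_tilings (R : realType) (d : nat) (L : Type)
    (T : nat -> set (tile R d L)) : Prop := {
  nested_tiling : forall n, tiling (T n) ;
  nested_cellular : forall n, cellular (T n) ;
  nested_patch : forall n t, T n.+1 t ->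
    exists2 p, patch_of (T n) p & psupport p = support t ;
  nested_label : forall n t a p p',
    T n.+1 t -> T n.+1 (tshift a t) ->
    patch_of (T n) p -> psupport p = support t ->
    patch_of (T n) p' -> psupport p' = support (tshift a t) ->
    p' = pshift a p ;
  nested_origin : exists2 t, T 0%N t & puncture t = 0 }.

Record proper_nested (R : realType) (d : nat) (L : Type)
    (T : nat -> set (tile R d L)) : Prop := {
  proper_is_nested : nested_tilings T ;
  proper_aperiodic : forall n, aperiodic (T n) ;
  proper_repetitive : forall n, repetitive (T n) ;
  proper_FLC : forall n, FLC (T n) ;
  proper_min_radius : forall n,
    (tile_inner_radius @` T n) (min_inner_radius (T n)) ;
  proper_min_radius_gt0 : forall n, 0 < min_inner_radius (T n) ;
  proper_max_radius : forall n,
    (tile_outer_radius @` T n) (max_outer_radius (T n)) /\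
    has_ubound (tile_outer_radius @` T n) ;
  proper_subst_patch : forall n t, T n.+1 t ->
    patch_of (T n) (subst (T n) (T n.+1) t) ;
  proper_subst_interior : forall n t, T n.+1 t ->
    exists2 u, subst (T n) (T n.+1) t u &
      support u `<=` interior (psupport (subst (T n) (T n.+1) t)) ;
  proper_growth : exists2 rho : R, 0 < rho & forall n,
    min_inner_radius (T n.+1) > min_inner_radius (T n) + rho /\
    max_outer_radius (T n.+1) > max_outer_radius (T n) + rho }.

(* The root of the diagram is [None]. *)
Definition vertex (R : realType) (d : nat) (L : Type) :=
  option (collared_tile R d L).

Record edge (R : realType) (d : nat) (L : Type) := Edge {
  esrc : vertex R d L ;
  erng : vertex R d L ;
  elab : 'rV[R]_d }.

HB.instance Definition _ (R : realType) (d : nat) (L : Type) :=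
  gen_eqMixin (edge R d L).
HB.instance Definition _ (R : realType) (d : nat) (L : Type) :=
  gen_choiceMixin (edge R d L).

Section Bratteli.
Context {R : realType} {d : nat} {L : Type}.
Variable T : nat -> set (tile R d L).
Local Notation V := 'rV[R]_d.
Local Notation tile := (tile R d L).
Local Notation vertex := (vertex R d L).
Local Notation edge := (edge R d L).

(* Edges with range at level [n]. *)
Definition edges (n : nat) : set edge :=
  if n is m.+1 then
    [set e | exists c c' a,
       [/\ prototiles (T m) c, prototiles (T m.+1) c',
           collared_subst (T m) (T m.+1) c' (cshift a c)
         & e = Edge (Some c) (Some c') (- a)]]
  else [set Edge None (Some c) 0 | c in prototiles (T 0%N)].

(* The [n]-th term of a path belongs to [edges n]. *)
Definition paths : set (prod_topology (fun _ : nat => discrete_topology edge)) :=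
  [set x | forall n, edges n (x n) /\ erng (x n) = esrc (x n.+1)].

Definition boundary : topologicalType := set_type paths.

Definition path_edge (x : boundary) (n : nat) : edge := val x n.

Definition vertex_collar (v : vertex) : set tile :=
  if v is Some c then c.2 else set0.

Fixpoint desubst (n : nat) (p : set tile) : set tile :=
  if n is m.+1 then desubst m (subst_patch (T m) (T m.+1) p) else p.

(* The patch p^c of the prefix of [x] with [n.+1] edges. *)
Definition collared_patch (x : boundary) (n : nat) : set tile :=
  pshift (\sum_(i < n.+1) elab (path_edge x i))
    (desubst n (vertex_collar (erng (path_edge x n)))).

(* For proper sequences there is exactly one such tiling. *)
Definition path_tiling (x : boundary) : set tile :=
  xget set0 [set T' | forall n,
    transversal_patch (T 0%N) (collared_patch x n) T'].

Definition horizontal (n : nat) : set edge :=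
  [set h | exists c c' a a' t t',
     [/\ prototiles (T n) c /\ prototiles (T n) c',
         (T n t /\ cshift a c = collared (T n) t) /\
           (T n t' /\ cshift a' c' = collared (T n) t'),
         collar (T n) t' t /\ collar (T n) t t'
       & h = Edge (Some c) (Some c') (a' - a)]].

Definition commutative_diagram (h e e' h' : edge) : Prop :=
  [/\ esrc h = esrc e, erng h = esrc e', erng e = esrc h',
      erng e' = erng h' & elab e + elab h' = elab h + elab e'].

Definition boundary_equiv (x y : boundary) : Prop :=
  exists (n0 : nat) (h : nat -> edge),
    (forall n, (n0 <= n)%N -> horizontal n (h n)) /\
    (forall n, (n0 < n)%N ->
       commutative_diagram (h n.-1) (path_edge x n) (path_edge y n) (h n)).

(* For proper sequences, if [boundary_equiv x y] then there is exactly one such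
   vector. *)
Definition translation_vector (x y : boundary) : V :=
  xget 0 [set a | path_tiling y = pshift a (path_tiling x)].

Definition boundary_graph : set (boundary * boundary) :=
  [set xy | boundary_equiv xy.1 xy.2].

(* Convergence in this topology is the convergence of [x] in the space of paths
   together with that of the translation vector in [R^d]. *)
Definition boundary_relation : topologicalType :=
  @initial_topology (set_type boundary_graph) (boundary * V)%type
    (fun xy => ((val xy).1, translation_vector (val xy).1 (val xy).2)).

Definition boundary_relation_val (g : boundary_relation) : boundary * boundary := val g.

End Bratteli.

Definition metrizable (R : realType) (X : topologicalType) : Prop :=
  exists m : X -> X -> R,
    [/\ forall x y, 0 <= m x y, forall x y, m x y = 0 <-> x = y,
        forall x y, m x y = m y x,
        forall x y z, m x z <= m x y + m y z
      & forall x (A : set X), nbhs x A <->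
          exists2 eps : R, 0 < eps & [set y | m x y < eps] `<=` A].

Definition local_homeomorphism (X Y : topologicalType) (f : X -> Y) : Prop :=
  forall x, exists U : set X,
    [/\ open U, U x, open (f @` U), {within U, continuous f}
      & exists2 g : Y -> X, (forall u, U u -> g (f u) = u)
          & {within f @` U, continuous g}].

Definition open_map (X Y : topologicalType) (f : X -> Y) : Prop :=
  forall A : set X, open A -> open (f @` A).

(* A topology on the graph of the relation [E] is given as a topological space
   [G] together with a bijection [pr] from [G] to that graph. *)
Section Etale.
Variables (R : realType) (X : topologicalType) (E : X -> X -> Prop).
Variables (G : topologicalType) (pr : G -> X * X).

Definition composable : set (G * G) :=
  [set gh | (pr gh.1).2 = (pr gh.2).1].

Record etale : Prop := {
  etale_refl : forall x, E x x ;
  etale_sym : forall x y, E x y -> E y x ;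
  etale_trans : forall x y z, E x y -> E y z -> E x z ;
  etale_compact : compact [set: X] ;
  etale_metrizable : metrizable R X ;
  etale_graph_inj : injective pr ;
  etale_graph : range pr = [set xy | E xy.1 xy.2] ;
  etale_composable_closed : closed composable ;
  etale_left : {within composable, continuous fst} ;
  etale_right : {within composable, continuous snd} ;
  etale_product : exists2 m : G * G -> G,
    forall gh, composable gh -> pr (m gh) = ((pr gh.1).1, (pr gh.2).2)
    & {within composable, continuous m} ;
  etale_diagonal : open [set g | (pr g).1 = (pr g).2] ;
  etale_r_open : open_map (fun g => (pr g).1) ;
  etale_r_local : local_homeomorphism (fun g => (pr g).1) ;
  etale_s_open : open_map (fun g => (pr g).2) ;
  etale_s_local : local_homeomorphism (fun g => (pr g).2) }.

End Etale.

(* Main.v *)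
(* Levels are counted from 0. Let r_n be the minimal inner radius of the
   tiles of T_n. The partial sums of the labels of a path x place its
   collared vertices in a nested family of collared tiles P_n(x), all
   containing the origin; each P_N(x) is a translate of a collared tile of
   T_N, and a translation realizing this (a "frame") determines translates
   of T_0, ..., T_N which around the origin, up to distance r_N, do not
   depend on the frame. As r_N tends to infinity these pieces glue to
   tilings X_n(x) of level n, with X_0(x) = T_x, from which the path is
   recovered.

   Then x ~ y if and only if X_n(y) = X_n(x) + a for some a and all n: the
   tiles P_n(x) and P_n(y) - a stay at distance at most |a|, hence are in
   each other's collar once r_n >= |a|. Conversely every tile of X_0(x),
   with puncture -a, is the origin of such a y. So R_B is the set of the
   pairs (x, a) with -a the puncture of a tile of T_x, and since punctures
   are r_0-separated and T_x around the origin depends only on a prefix of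
   x, the vector a is locally constant. *)
Require Import Defs.
From mathcomp Require Import all_boot all_order all_algebra.
From mathcomp Require Import all_classical all_reals all_analysis.
From mathcomp Require Import ring lra.
(* Again, because the library has its own [edist]. *)
Require Import Defs.

Set Implicit Arguments.
Unset Strict Implicit.
Unset Printing Implicit Defensive.

Import Order.TTheory GRing.Theory Num.Theory.
Import numFieldNormedType.Exports.

Local Open Scope classical_set_scope.
Local Open Scope ring_scope.

(** * The Euclidean norm *)
Section EuclideanNorm.
Context {R : realType} {d : nat}.
Implicit Types u v w x y z : 'rV[R]_d.

Lemma sum_sqr_ge0 v : 0 <= \sum_(i < d) v ord0 i ^+ 2.
Proof. by apply: sumr_ge0 => i _; exact: sqr_ge0. Qed.

Lemma enorm_ge0 v : 0 <= enorm v.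
Proof. exact: sqrtr_ge0. Qed.

Lemma sqr_enorm v : enorm v ^+ 2 = \sum_(i < d) v ord0 i ^+ 2.
Proof. by rewrite sqr_sqrtr// sum_sqr_ge0. Qed.

Lemma enorm0 : enorm (0 : 'rV[R]_d) = 0.
Proof.
by rewrite /enorm big1 ?sqrtr0// => i _; rewrite mxE expr0n.
Qed.

Lemma enorm_le0 v : enorm v <= 0 -> v = 0.
Proof.
move=> v0; have {}v0 : enorm v = 0 by apply/le_anti; rewrite v0 enorm_ge0.
apply/rowP => i; rewrite mxE; have /esym/eqP := sqr_enorm v; rewrite v0 expr0n.
rewrite psumr_eq0 => [/allP/(_ i (mem_index_enum _))|j _]; last exact: sqr_ge0.
by rewrite /= sqrf_eq0 => /eqP.
Qed.

Lemma enormN v : enorm (- v) = enorm v.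
Proof. by congr Num.sqrt; apply: eq_bigr => i _; rewrite mxE sqrrN. Qed.

Lemma enormBC u v : enorm (u - v) = enorm (v - u).
Proof. by rewrite -enormN opprB. Qed.

(** Cauchy-Schwarz: the sum of the squares of a u_i - b v_i is a nonnegative quadratic form in (a,
    b). The values a = |v|, b = |u| settle the case of nonzero norms. *)
Lemma sum_mul_le_enorm u v :
  \sum_(i < d) u ord0 i * v ord0 i <= enorm u * enorm v.
Proof.
set s := \sum_(i < d) _.
have sE (a b : R) : \sum_(i < d) (a * u ord0 i - b * v ord0 i) ^+ 2 =
    a ^+ 2 * enorm u ^+ 2 - (2 * a * b) * s + b ^+ 2 * enorm v ^+ 2.
  rewrite !sqr_enorm !mulr_sumr -sumrB -big_split/=.
  by apply: eq_bigr => i _; ring.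
have s_ge0 (a b : R) :
    0 <= a ^+ 2 * enorm u ^+ 2 - (2 * a * b) * s + b ^+ 2 * enorm v ^+ 2.
  by rewrite -sE; apply: sumr_ge0 => i _; exact: sqr_ge0.
have /predU1P[u0|u0] : (0 == enorm u) || (0 < enorm u) by rewrite -le_eqVlt enorm_ge0.
all: have /predU1P[v0|v0] : (0 == enorm v) || (0 < enorm v)
  by rewrite -le_eqVlt enorm_ge0.
- by have := s_ge0 1 1; rewrite -v0 -u0; lra.
(* With |u| = 0 and (a, b) = (|v|^2, s) the form equals -|v|^2 s^2, which excludes s > 0. The next
   case is symmetric. *)
- have := s_ge0 (enorm v ^+ 2) s; rewrite -u0 => H.
  rewrite mul0r leNgt; apply/negP => s0.
  by have := mulr_gt0 (mulr_gt0 s0 s0) (mulr_gt0 v0 v0); nra.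
- have := s_ge0 s (enorm u ^+ 2); rewrite -v0 => H.
  rewrite mulr0 leNgt; apply/negP => s0.
  by have := mulr_gt0 (mulr_gt0 s0 s0) (mulr_gt0 u0 u0); nra.
have := s_ge0 (enorm v) (enorm u) => H; rewrite leNgt; apply/negP => us.
have : 0 < 2 * (enorm u * enorm v) * (s - enorm u * enorm v).
  by rewrite !mulr_gt0// subr_gt0.
by nra.
Qed.

Lemma enormD u v : enorm (u + v) <= enorm u + enorm v.
Proof.
rewrite -(@ler_pXn2r _ 2%N) ?nnegrE ?addr_ge0 ?enorm_ge0//.
have -> : enorm (u + v) ^+ 2 =
    enorm u ^+ 2 + 2 * (\sum_(i < d) u ord0 i * v ord0 i) + enorm v ^+ 2.
  rewrite !sqr_enorm mulr_sumr -!big_split/=.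
  by apply: eq_bigr => i _; rewrite mxE; ring.
by have := sum_mul_le_enorm u v; rewrite sqrrD; lra.
Qed.

Lemma enorm_triangle z x y : enorm (x - y) <= enorm (x - z) + enorm (z - y).
Proof. by rewrite -(subrKA z) enormD. Qed.

Lemma enorm_le_norm v : enorm v <= d%:R * `|v|.
Proof.
rewrite -(@ler_pXn2r _ 2%N) ?nnegrE ?mulr_ge0 ?enorm_ge0//.
rewrite sqr_enorm.
apply: (@le_trans _ _ (\sum_(i < d) `|v| ^+ 2)).
  apply: ler_sum => i _; rewrite -(real_normK (num_real (v ord0 i))).
  rewrite ler_pXn2r ?nnegrE// [leRHS]/Num.norm/= mx_normrE.
  exact: (le_bigmax 0 (fun i => `|v i.1 i.2|) (ord0, i)).
rewrite sumr_const card_ord -[leLHS]mulr_natl exprMn ler_wpM2r ?sqr_ge0// -natrX.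
by rewrite ler_nat; case: (d) => // n; rewrite leq_pmulr.
Qed.

Lemma nbhs_eball x (rho : R) : 0 < rho -> nbhs x (eball x rho).
Proof.
move=> rho0; apply/nbhs_ballP; exists (rho / d.+1%:R) => /=.
  by rewrite divr_gt0.
(* The Euclidean norm is at most d times the sup norm; dividing by d + 1 also covers d = 0. *)
move=> y; rewrite -ball_normE/= => xy.
rewrite /eball/= enormBC (le_lt_trans (enorm_le_norm _))//.
apply: (@le_lt_trans _ _ (d.+1%:R * `|x - y|)).
  by rewrite ler_wpM2r// ler_nat.
by rewrite mulrC -ltr_pdivlMr.
Qed.

Lemma compact_enorm_bounded (A : set 'rV[R]_d) : compact A ->
  exists2 K : R, 0 < K & forall y, A y -> enorm y <= K.
Proof.
move=> /compact_bounded[M [_ HM]]; exists (d%:R * (`|M| + 1) + 1).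
  by rewrite ltr_wpDl// mulr_ge0// addr_ge0.
move=> y Ay; rewrite (le_trans (enorm_le_norm _))//.
apply: (@le_trans _ _ (d%:R * (`|M| + 1))); last by rewrite lerDl.
rewrite ler_wpM2l//.
by apply: (HM (`|M| + 1)) => //; rewrite (le_lt_trans (ler_norm _))// ltrDl.
Qed.

Lemma edist_le (A B : set 'rV[R]_d) x y : A x -> B y ->
  edist A B <= enorm (y - x).
Proof.
move=> Ax By; apply: ge_inf; last by exists x, y.
by exists 0 => _ [u [v [_ _ ->]]]; exact: enorm_ge0.
Qed.

(** Nonemptiness excludes the default value 0 of the infimum of an empty set. *)
Lemma edist_lt (A B : set 'rV[R]_d) (rho : R) : A !=set0 -> B !=set0 ->
  edist A B < rho -> exists x y, [/\ A x, B y & enorm (y - x) < rho].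
Proof.
move=> [x Ax] [y By] /inf_lt[|_ [u [v [Au Bv ->]]] H].
  by exists (enorm (y - x)), x, y.
by exists u, v.
Qed.

Lemma edistC (A B : set 'rV[R]_d) : edist A B = edist B A.
Proof.
by congr inf; apply/seteqP; split => _ [x [y [Ax By ->]]];
  exists y, x; rewrite enormBC.
Qed.

Lemma eball_inner_radius x (A : set 'rV[R]_d) rho :
  compact A -> A x -> rho <= inner_radius x A -> eball x rho `<=` A.
Proof.
move=> cA Ax rhoA y /= xy.
have [|e [e0 eA] ye] := @sup_gt _ _ (enorm (y - x)) _ (lt_le_trans xy rhoA).
  by exists 0; split => // z; rewrite /eclosed_ball/= => /enorm_le0 /subr0_eq->.
by apply: eA; exact: ltW.
Qed.

End EuclideanNorm.

(** * Translations of tiles and tilings *)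
Section Shifts.
Context {R : realType} {d : nat} {L : Type}.
Local Notation V := 'rV[R]_d.
Local Notation tile := (tile R d L).
Implicit Types (t u : tile) (p q S T : set tile) (a b x y : V) (A : set V).

Lemma nbhs_subr A a y : nbhs y [set z | A (z - a)] <-> nbhs (y - a) A.
Proof.
split=> [H|H].
  have : (fun z : V => z + a) @ (y - a) --> y.
    by rewrite -{2}(subrK a y); exact: cvgD (@cvg_id _ _) (@cvg_cst _ _ _ _ _).
  move=> /(_ _ H); rewrite nbhs_simpl/=.
  by apply: filterS => z /=; rewrite addrK.
have : (fun z : V => z - a) @ y --> y - a.
  exact: cvgB (@cvg_id _ _) (@cvg_cst _ _ _ _ _).
by move=> /(_ _ H); rewrite nbhs_simpl/=.
Qed.

Lemma interior_subr A a : [set y | A (y - a)]^° = [set y | A^° (y - a)].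
Proof. by apply/seteqP; split => y; rewrite /interior/= nbhs_subr. Qed.

Lemma closure_subr A a :
  closure [set y | A (y - a)] = [set y | closure A (y - a)].
Proof.
apply/seteqP; split => y cA B.
  move=> By; have [z [Az Bz]] := cA _ (proj2 (nbhs_subr B a y) By).
  by exists (z - a).
move=> By.
have : nbhs (y - a) [set z | B (z - - a)] by rewrite nbhs_subr opprK subrK.
move=> /cA[z [Az Bz]]; exists (z + a); split => /=; first by rewrite addrK.
by rewrite -[a]opprK.
Qed.

Lemma support_tshift a t : support (tshift a t) = [set y | support t (y - a)].
Proof.
apply/seteqP; split=> [_ [y ty <-]|y ty]; first by rewrite /= addrK.
by exists (y - a) => //; rewrite subrK.
Qed.

Lemma tshiftD a b t : tshift a (tshift b t) = tshift (b + a) t.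
Proof.
rewrite /tshift -/(tshift a _) -/(tshift b _) /= addrA; congr Tile.
apply/seteqP; split=> [_ [_ [y ty <-] <-]|_ [y ty <-]].
  by exists y => //; rewrite addrA.
by exists (y + b); [exists y|rewrite addrA].
Qed.

Lemma tshift0 t : tshift 0 t = t.
Proof.
case: t => A x l; rewrite /tshift/= addr0; congr Tile.
by apply/seteqP; split=> [_ [y ty <-]|y ty]; rewrite ?addr0//; exists y; rewrite ?addr0.
Qed.

Lemma tshiftK a t : tshift (- a) (tshift a t) = t.
Proof. by rewrite tshiftD subrr tshift0. Qed.

Lemma tshiftNK a t : tshift a (tshift (- a) t) = t.
Proof. by rewrite tshiftD addNr tshift0. Qed.

Lemma pshiftE a p t : pshift a p t <-> p (tshift (- a) t).
Proof.
split=> [[u pu <-]|pt]; first by rewrite tshiftK.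
by exists (tshift (- a) t) => //; rewrite tshiftNK.
Qed.

Lemma pshift_tshift a p t : pshift a p (tshift a t) <-> p t.
Proof. by rewrite pshiftE tshiftK. Qed.

Lemma pshiftD a b p : pshift a (pshift b p) = pshift (b + a) p.
Proof.
by apply/seteqP; split=> t /=; rewrite !pshiftE tshiftD opprD addrC.
Qed.

Lemma pshift0 p : pshift 0 p = p.
Proof. by apply/seteqP; split=> t /=; rewrite !pshiftE oppr0 tshift0. Qed.

Lemma pshiftK a p : pshift (- a) (pshift a p) = p.
Proof. by rewrite pshiftD subrr pshift0. Qed.

Lemma cshiftD a b (c : collared_tile R d L) :
  cshift a (cshift b c) = cshift (b + a) c.
Proof. by rewrite /cshift/= tshiftD pshiftD. Qed.

Lemma cshift0 (c : collared_tile R d L) : cshift 0 c = c.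
Proof. by case: c => t p; rewrite /cshift/= tshift0 pshift0. Qed.

Lemma cshiftK a (c : collared_tile R d L) : cshift (- a) (cshift a c) = c.
Proof. by rewrite cshiftD subrr cshift0. Qed.

Lemma interior_tshift a t :
  (support (tshift a t))^° = [set y | (support t)^° (y - a)].
Proof. by rewrite support_tshift interior_subr. Qed.

Lemma is_tile_tshift a t : is_tile t -> is_tile (tshift a t).
Proof.
case=> ct it pt; split.
- apply: (@continuous_compact _ _ (fun y => y + a)) => //.
  apply: continuous_subspaceT => y.
  exact: cvgD (@cvg_id _ _) (@cvg_cst _ _ _ _ _).
- by rewrite interior_tshift closure_subr it support_tshift.
- by rewrite support_tshift/= addrK.
Qed.

Lemma tile_support_neq0 t : is_tile t -> support t !=set0.
Proof. by case=> _ _ pt; exists (puncture t). Qed.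

(** A tile is the closure of its interior, so a neighbourhood of any of its points meets that
    interior. *)
Lemma tile_meets_interior t A y : is_tile t -> support t y -> A^° y ->
  exists2 z, (support t)^° z & A^° z.
Proof.
move=> [_ it _]; rewrite -{1}it => ty /nbhs_interior/ty[z [tz Az]].
by exists z.
Qed.

Lemma tile_interior_neq0 t : is_tile t -> exists y, (support t)^° y.
Proof.
move=> t_tile; have [_ _ pt] := t_tile.
have [z tz _] := tile_meets_interior t_tile pt (filterT : setT^° (puncture t)).
by exists z.
Qed.

Lemma psupport_pshift a p : psupport (pshift a p) = [set y | psupport p (y - a)].
Proof.
apply/seteqP; split=> [y [_ [t pt <-]]|y [t pt ty]].
  by rewrite support_tshift => ty; exists t.
by exists (tshift a t); [exists t|rewrite support_tshift].
Qed.

Lemma edist_tshift a t u :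
  edist (support (tshift a t)) (support (tshift a u)) =
  edist (support t) (support u).
Proof.
congr inf; apply/seteqP; split => r [x [y [Hx Hy ->]]].
  exists (x - a), (y - a); move: Hx Hy; rewrite !support_tshift.
  by split => //; congr enorm; rewrite opprB addrA subrK.
exists (x + a), (y + a); rewrite !support_tshift/= !addrK; split => //.
by congr enorm; rewrite opprD addrACA subrr addr0.
Qed.

Lemma tile_inner_radius_tshift a t :
  tile_inner_radius (tshift a t) = tile_inner_radius t.
Proof.
congr sup; apply/seteqP; split => r [r0 H]; split => // y Hy.
  have : support (tshift a t) (y + a).
    by apply: H; move: Hy; rewrite /eclosed_ball/= opprD addrACA subrr addr0.
  by rewrite support_tshift/= addrK.
rewrite support_tshift/=; apply: H; move: Hy; rewrite /eclosed_ball/=.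
by rewrite opprD addrA addrAC.
Qed.

Lemma min_inner_radius_pshift a T :
  min_inner_radius (pshift a T) = min_inner_radius T.
Proof.
congr inf; apply/seteqP; split => [_ [_ [t Tt <-] <-]|_ [t Tt <-]].
  by exists t => //; rewrite tile_inner_radius_tshift.
by exists (tshift a t); [exists t|rewrite tile_inner_radius_tshift].
Qed.

Lemma collar_tshift a T t : collar (pshift a T) (tshift a t) = pshift a (collar T t).
Proof.
apply/seteqP; split => u.
  rewrite pshiftE => -[/pshiftE Tu]; rewrite -{1}(tshiftNK a u) edist_tshift.
  by rewrite min_inner_radius_pshift.
move=> [w [Tw tw] <-]; split; first by exists w.
by rewrite edist_tshift min_inner_radius_pshift.
Qed.

Lemma collared_tshift a T t :
  collared (pshift a T) (tshift a t) = cshift a (collared T t).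
Proof. by rewrite /collared collar_tshift. Qed.

Lemma min_inner_radius_le T t : T t -> min_inner_radius T <= tile_inner_radius t.
Proof.
move=> Tt; apply: ge_inf; last by exists t.
exists 0 => _ [u _ <-]; rewrite /tile_inner_radius /inner_radius.
(* Without a supremum, [sup] takes its default value 0, which is still nonnegative. *)
set A := [set _ | _]; have [sA|sA] := pselect (has_sup A); last by rewrite sup_out.
have [[r Ar] _] := sA; apply: (@le_trans _ _ r); first by case: Ar.
by apply: ub_le_sup => //; case: sA.
Qed.

Section Tiling.
Variable T : set tile.
Hypothesis tT : tiling T.

Lemma tiling_tile t : T t -> is_tile t.
Proof. by case: tT => _ + _ _ => /(_ t). Qed.

Lemma tiling_cover y : exists2 t, T t & support t y.
Proof.
by case: tT => _ _ _; move=> /seteqP[_ /(_ y I)] [t]; exists t.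
Qed.

Lemma tiling_eq t u y : T t -> T u -> (support t)^° y -> (support u)^° y -> t = u.
Proof.
by move=> Tt Tu ty uy; case: tT => _ _ /(_ t u Tt Tu) + _; apply; exists y.
Qed.

Lemma tiling_meet_eq t u y : T t -> T u -> (support t)^° y -> support u y -> t = u.
Proof.
move=> Tt Tu ty uy.
have [z uz tz] := tile_meets_interior (tiling_tile Tu) uy ty.
exact: tiling_eq tz uz.
Qed.

Lemma tiling_sub_eq t u : T t -> T u -> support t `<=` support u -> t = u.
Proof.
move=> Tt Tu tu; have [y ty] := tile_interior_neq0 (tiling_tile Tt).
exact: (tiling_meet_eq Tt Tu ty (tu _ (interior_subset ty))).
Qed.

Lemma patch_sub_mem p t y : p `<=` T -> T t -> (support t)^° y -> psupport p y ->
  p t.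
Proof.
by move=> pT Tt ty [u pu uy]; rewrite (tiling_meet_eq Tt (pT _ pu) ty uy).
Qed.

Lemma tiling_pshift a : tiling (pshift a T).
Proof.
have [cT _ _ _] := tT; split.
- exact: card_le_trans (card_image_le _ _) cT.
- by move=> _ [t Tt <-]; apply: is_tile_tshift; exact: tiling_tile.
- move=> _ _ [t Tt <-] [u Tu <-] [y []]; rewrite !interior_tshift => ty uy.
  by rewrite (tiling_eq Tt Tu ty uy).
- rewrite psupport_pshift; apply/seteqP; split=> // y _.
  by have [t Tt ty] := tiling_cover (y - a); exists t.
Qed.

Lemma eball_puncture t : T t ->
  eball (puncture t) (min_inner_radius T) `<=` (support t)^°.
Proof.
move=> Tt; have [ct _ pt] := tiling_tile Tt => y ty.
have rho0 : 0 < min_inner_radius T - enorm (y - puncture t) by rewrite subr_gt0.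
apply: filterS (nbhs_eball y rho0) => z yz.
apply: (eball_inner_radius ct pt (min_inner_radius_le Tt)).
rewrite /eball/= (le_lt_trans (enorm_triangle y _ _))//.
by move: yz; rewrite /eball/=; lra.
Qed.

(** The open ball of this radius around a puncture lies in the interior of its own tile, where no
    other tile has a point. *)
Lemma puncture_separated t u : T t -> T u ->
  enorm (puncture t - puncture u) < min_inner_radius T -> t = u.
Proof.
move=> Tt Tu tu; have [_ _ pt] := tiling_tile Tt.
by apply/esym/(tiling_meet_eq Tu Tt _ pt)/eball_puncture.
Qed.

End Tiling.

(** An interior point of a tile of [T] is covered by a tile of [S], which is also in [T] and
    therefore is that tile. *)
Lemma tiling_subset_eq S T : tiling S -> tiling T -> S `<=` T -> S = T.
Proof.
move=> tS tT ST; apply/seteqP; split => // t Tt.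
have [y ty] := tile_interior_neq0 (tiling_tile tT Tt).
have [s Ss sy] := tiling_cover tS y.
by rewrite (tiling_meet_eq tT Tt (ST _ Ss) ty sy).
Qed.

End Shifts.

(** * Frames of a path *)
Section Nested.
Context {R : realType} {d : nat} {L : Type}.
Local Notation V := 'rV[R]_d.
Local Notation tile := (tile R d L).
Variable T : nat -> set tile.
Hypothesis HT : proper_nested T.
Implicit Types (t s v w : tile) (p : set tile) (a b y : V) (n N M : nat).

Local Notation radius n := (min_inner_radius (T n)).

(** * Growth of the radii and nesting of the levels *)

Lemma nested_tilingP n : tiling (T n).
Proof. exact: nested_tiling (proper_is_nested HT) n. Qed.

Lemma shifted_tiling b n : tiling (pshift b (T n)).
Proof. exact: (tiling_pshift (nested_tilingP n) b). Qed.

Lemma radius_le n N : (n <= N)%N -> radius n <= radius N.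
Proof.
have [rho rho0 H] := proper_growth HT.
elim: N => [|N IH]; first by rewrite leqn0 => /eqP->.
rewrite leq_eqVlt => /predU1P[->//|]; rewrite ltnS => /IH/le_trans; apply.
by have [] := H N; lra.
Qed.

Lemma radius_lt n N : (n < N)%N -> radius n < radius N.
Proof.
move=> /radius_le; apply: lt_le_trans.
by have [rho rho0 H] := proper_growth HT; have [] := H n; lra.
Qed.

Lemma radius_unbounded (K : R) : exists N0, forall N, (N0 <= N)%N -> K <= radius N.
Proof.
have [rho rho0 H] := proper_growth HT.
have rho_le n : n%:R * rho <= radius n.
  elim: n => [|n IH]; first by rewrite mul0r ltW// (proper_min_radius_gt0 HT).
  by have [] := H n; rewrite -natr1; lra.
exists (Num.bound `|K / rho|) => N KN; apply: le_trans (rho_le N).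
rewrite -ler_pdivrMr// (le_trans (ler_norm _))//.
by rewrite (le_trans (ltW (archi_boundP _)))// ler_nat.
Qed.

(** The tile of [T n.+1] covering an interior point of [t] is the support of a patch of [T n], and
    only [t] can cover that point in the patch. *)
Lemma parent n t : T n t -> exists2 s, T n.+1 s & support t `<=` support s.
Proof.
move=> Tt; have [y ty] := tile_interior_neq0 (tiling_tile (nested_tilingP n) Tt).
have [s Ts sy] := tiling_cover (nested_tilingP n.+1) y.
exists s => //; have [p [[_ _ _] pT] ps] := nested_patch (proper_is_nested HT) Ts.
rewrite -ps => z tz; exists t => //.
by apply: (patch_sub_mem (nested_tilingP n) pT Tt ty); rewrite ps.
Qed.

(** Equal labels force equal subdivisions. Going down one level, [nested_label] makes the patch
    below [tshift a s] the translate of the patch below [s]; [t] lies in a single tile [w] of the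
    latter, and the induction continues with [w]. *)
Lemma nest_tshift n N a s t : (n <= N)%N -> T N s -> T N (tshift a s) ->
  T n t -> support t `<=` support s -> T n (tshift a t).
Proof.
move=> /subnKC <-; elim: (N - n)%N s t => [|k IH] s t.
  rewrite addn0 => Ts Tas Tt ts.
  by rewrite (tiling_sub_eq (nested_tilingP n) Tt Ts ts).
rewrite addnS => Ts Tas Tt ts.
have [q [qp qT] qs] := nested_patch (proper_is_nested HT) Ts.
have [q' [q'p q'T] q's] := nested_patch (proper_is_nested HT) Tas.
have q'E := nested_label (proper_is_nested HT) Ts Tas (conj qp qT) qs
  (conj q'p q'T) q's.
have [y ty] := tile_interior_neq0 (tiling_tile (nested_tilingP n) Tt).
have [w qw wy] : psupport q y by rewrite qs; exact: ts (interior_subset ty).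
(* The ancestor [w'] of [t] at level n + k meets the interior of [w], hence equals [w]; so [t] is
   entirely inside [w]. *)
have [w' Tw' tw'] : exists2 w', T (n + k)%N w' & support t `<=` support w'.
  elim: (k) {IH Ts Tas ts q qp qT qs q' q'p q'T q's q'E w qw wy} => [|j [w Tw tw]].
    by exists t => //; rewrite addn0.
  by have [w' Tw' ww'] := parent Tw; exists w';
    [rewrite addnS|exact: subset_trans tw ww'].
have [z wz tz] := tile_meets_interior
  (tiling_tile (nested_tilingP _) (qT _ qw)) wy ty.
have ww' : w = w'.
  apply: (tiling_meet_eq (nested_tilingP _) (qT _ qw) Tw' wz).
  exact: tw' (interior_subset tz).
rewrite -{w'}ww' in Tw' tw'.
apply: (IH w) => //; apply: q'T; rewrite q'E; exact/pshift_tshift.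
Qed.

Lemma ancestor n N t : (n <= N)%N -> T n t ->
  exists2 s, T N s & support t `<=` support s.
Proof.
move=> /subnKC <- Tt; elim: (N - n)%N => [|k [s Ts ts]].
  by exists t => //; rewrite addn0.
by have [w Tw sw] := parent Ts; exists w; [rewrite addnS|exact: subset_trans ts sw].
Qed.

Lemma shifted_ancestor b n N t : (n <= N)%N -> pshift b (T n) t ->
  exists2 s, pshift b (T N) s & support t `<=` support s.
Proof.
move=> nN [u Tu <-]; have [s Ts us] := ancestor nN Tu.
by exists (tshift b s); [exists s|rewrite !support_tshift => y /us].
Qed.

Lemma shifted_nest n N b b' w t : (n <= N)%N ->
  pshift b (T N) w -> pshift b' (T N) w -> pshift b (T n) t ->
  support t `<=` support w -> pshift b' (T n) t.
Proof.
move=> nN [s Ts <-] /pshiftE; rewrite tshiftD => Tbs [u Tu <-].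
rewrite !support_tshift => us; apply/pshiftE; rewrite tshiftD.
by apply: (nest_tshift nN Ts) => // y uy; rewrite -(addrK b y); apply: us => /=; rewrite addrK.
Qed.

(** [subst] ranges over all ways to write the tile as a translate of a tile of [T n.+1]; by
    [shifted_nest] they all yield the same tiles. *)
Lemma substE n s a u : T n.+1 s ->
  subst (T n) (T n.+1) (tshift a s) u <->
  pshift a (T n) u /\ support u `<=` support (tshift a s).
Proof.
move=> Ts; split=> [[s' [a' [p [Ts' asE [pp pT] ps' [w pw <-]]]]]|[Tu us]].
  have us : support (tshift a' w) `<=` support (tshift a s).
    by rewrite asE !support_tshift -ps' => y wy; exists w.
  split=> //; apply: (@shifted_nest _ n.+1 a' a (tshift a s)) => //.
  - by rewrite asE; exists s'.
  - by exists s.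
  - by exists w => //; exact: pT.
have [p pP ps] := nested_patch (proper_is_nested HT) Ts.
exists s, a, p; split=> //; apply/pshiftE; move/pshiftE : Tu => Tu.
have [y uy] := tile_interior_neq0 (tiling_tile (nested_tilingP n) Tu).
apply: (patch_sub_mem (nested_tilingP n) (proj2 pP) Tu uy).
rewrite ps; have := interior_subset uy; rewrite support_tshift opprK => /us.
by rewrite support_tshift/= addrK.
Qed.

(* Two translates of the nested sequence sharing a collared tile of level [N]
   agree around it at all lower levels. *)
Lemma collared_near n N b b' s t : (n <= N)%N ->
  pshift b (T N) s -> pshift b' (T N) s ->
  collared (pshift b (T N)) s = collared (pshift b' (T N)) s ->
  (exists y z, [/\ support t y, support s z & enorm (z - y) <= radius N]) ->
  pshift b (T n) t -> pshift b' (T n) t.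
Proof.
move=> nN Ss S's [cE] [y [z [ty sz yz]]] St.
have [w Sw tw] := shifted_ancestor nN St.
have : collar (pshift b (T N)) s w.
  split=> //; rewrite min_inner_radius_pshift edistC (le_trans _ yz)//.
  by apply: edist_le => //; exact: tw.
rewrite cE => -[S'w _]; exact: (shifted_nest nN Sw S'w).
Qed.

(** [collared_near] applies to [v] and to its whole collar, which stays within r_n of [s]. The
    strict inequality r_n < r_N leaves room for points whose distance only approaches the infimum in
    [edist]. *)
Lemma collared_sub n N b b' s v : (n < N)%N ->
  pshift b (T N) s -> pshift b' (T N) s ->
  collared (pshift b (T N)) s = collared (pshift b' (T N)) s ->
  pshift b (T n) v -> support v `<=` support s ->
  pshift b' (T n) v /\ collared (pshift b (T n)) v = collared (pshift b' (T n)) v.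
Proof.
move=> nN Ss S's cE Sv vs.
have v_tile := tiling_tile (shifted_tiling b n) Sv.
have near a w : edist (support v) (support w) <= radius n ->
    pshift a (T n) w ->
    exists y z, [/\ support w y, support s z & enorm (z - y) <= radius N].
  move=> vw Sw; have w_tile := tiling_tile (shifted_tiling a n) Sw.
  have [y [z [vy wz yz]]] := edist_lt (tile_support_neq0 v_tile)
    (tile_support_neq0 w_tile) (le_lt_trans vw (radius_lt nN)).
  by exists z, y; rewrite enormBC ltW//; split => //; exact: vs.
have S'v : pshift b' (T n) v.
  apply: (collared_near (ltnW nN) Ss S's cE _ Sv).
  have [y vy] := tile_support_neq0 v_tile.
  exists y, y; split=> //; first exact: vs.
  by rewrite subrr enorm0 ltW// (proper_min_radius_gt0 HT).
split => //; congr pair; apply/seteqP; split => w [Sw];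
  rewrite min_inner_radius_pshift => vw; split;
  rewrite ?min_inner_radius_pshift//.
- exact: (collared_near (ltnW nN) Ss S's cE (near _ _ vw Sw) Sw).
- exact: (collared_near (ltnW nN) S's Ss (esym cE) (near _ _ vw Sw) Sw).
Qed.

(** * Placed tiles and frames of a path *)

Local Notation boundary := (boundary T).
Implicit Types x : boundary.

Definition path_shift x n : V := \sum_(i < n.+1) elab (path_edge x i).

Lemma path_vertex_ex x n :
  exists c, prototiles (T n) c /\ erng (path_edge x n) = Some c.
Proof.
have [+ _] := set_valP x n; rewrite /path_edge -/(val x).
case: n => [|n] /=; first by move=> [c cT <-]; exists c.
by move=> [c [c' [a [_ c'T _ ->]]]]; exists c'.
Qed.

Definition path_vertex x n := sval (cid (path_vertex_ex x n)).

Lemma path_vertexP x n :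
  prototiles (T n) (path_vertex x n) /\ erng (path_edge x n) = Some (path_vertex x n).
Proof. exact: (svalP (cid (path_vertex_ex x n))). Qed.

(** This is P_n(x). The partial sums put the tiles of all levels into one coordinate system, in
    which the tile of level 0 has its puncture at 0. *)
Definition path_tile x n : collared_tile R d L :=
  cshift (path_shift x n) (path_vertex x n).

Arguments path_tile : simpl never.

(** Only level [n] is constrained; by [is_frame_le] the same vector is then a frame at all lower
    levels. *)
Definition is_frame x n b :=
  pshift b (T n) (path_tile x n).1 /\
  path_tile x n = collared (pshift b (T n)) (path_tile x n).1.

Lemma is_frame_ex x n : exists b, is_frame x n b.
Proof.
have [[t Tt ct] _] := path_vertexP x n.
exists (- puncture t + path_shift x n).
rewrite /is_frame.
have -> : path_tile x n = collared (pshift (- puncture t + path_shift x n) (T n))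
    (tshift (- puncture t + path_shift x n) t).
  by rewrite collared_tshift -cshiftD ct.
by split => //; exists t.
Qed.

Lemma path_shiftS x n :
  path_shift x n.+1 = path_shift x n + elab (path_edge x n.+1).
Proof. by rewrite /path_shift big_ord_recr. Qed.

Lemma path_edge_src x n : esrc (path_edge x n.+1) = erng (path_edge x n).
Proof. by have [_ <-] := set_valP x n. Qed.

Lemma path_edgeS x n : path_edge x n.+1 =
  Edge (Some (path_vertex x n)) (Some (path_vertex x n.+1))
    (path_shift x n.+1 - path_shift x n).
Proof.
rewrite path_shiftS addrC addKr.
have [_ +] := path_vertexP x n; have [_ <-] := path_vertexP x n.+1.
by rewrite -path_edge_src => <-; case: (path_edge x n.+1).
Qed.

Lemma path_edge0 x : path_edge x 0%N = Edge None (Some (path_vertex x 0%N)) 0.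
Proof.
have [_ <-] := path_vertexP x 0%N; rewrite /path_edge.
by have [/= [c _ <-] _] := set_valP x 0%N.
Qed.

(** The witnesses of the edge from level n to level n + 1 place both of its ends in one translate of
    the sequence. *)
Lemma path_tile_frame_ex x n : exists b, [/\ is_frame x n b, is_frame x n.+1 b &
  support (path_tile x n).1 `<=` support (path_tile x n.+1).1].
Proof.
have [+ _] := set_valP x n.+1; rewrite -/(path_edge x n.+1) path_edgeS.
move=> [c [c' [a [_ _ [s [b [v [Ts c'E sv acE]]]] [cE c'E' aE]]]]].
have {}cE : path_tile x n = cshift (b + path_shift x n.+1) (collared (T n) v).
  rewrite -cshiftD -acE cshiftD /path_tile cE; congr (cshift _ c).
  by rewrite -[a]opprK -aE opprB subrK.
have {}c'E' : path_tile x n.+1 =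
    cshift (b + path_shift x n.+1) (collared (T n.+1) s).
  by rewrite -cshiftD -c'E /path_tile c'E'.
have [Tv vs] : T n v /\ support v `<=` support s.
  by rewrite -(pshift0 (T n)) -(tshift0 s) -substE// tshift0.
exists (b + path_shift x n.+1); split.
- by rewrite /is_frame cE collared_tshift; split => //; exists v.
- by rewrite /is_frame c'E' collared_tshift; split => //; exists s.
- set e := b + _ in cE c'E' *.
  have : support (tshift e v) `<=` support (tshift e s).
    by rewrite !support_tshift => y /vs.
  by rewrite cE c'E'.
Qed.

(** An arbitrary frame is compared with the one of [path_tile_frame_ex]: they share the collared
    tile of level n + 1, which determines the collared tiles inside it. *)
Lemma is_frame_pred x n b : is_frame x n.+1 b -> is_frame x n b.
Proof.
move=> [S'P PE']; have [b' [[SP PE] [SP1 PE1] PP]] := path_tile_frame_ex x n.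
have := collared_sub (leqnn _) SP1 S'P; rewrite -PE1 -PE' => /(_ _ erefl SP PP).
by move=> [H1 H2]; split => //; rewrite -H2.
Qed.

Lemma is_frame_le x n N b : (n <= N)%N -> is_frame x N b -> is_frame x n b.
Proof.
move=> /subnKC <-; elim: (N - n)%N => [|k IH]; first by rewrite addn0.
by rewrite addnS => /is_frame_pred.
Qed.

Lemma path_tileS x n : support (path_tile x n).1 `<=` support (path_tile x n.+1).1.
Proof. by have [b []] := path_tile_frame_ex x n. Qed.

Lemma path_tile_is_tile x n : is_tile (path_tile x n).1.
Proof.
have [b [SP _]] := is_frame_ex x n; exact: (tiling_tile (shifted_tiling b n) SP).
Qed.

Lemma path_vertex_puncture x n : puncture (path_vertex x n).1 = 0.
Proof. by have [[t _ <-] _] := path_vertexP x n; rewrite /= subrr. Qed.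

Lemma path_tile_puncture x n : puncture (path_tile x n).1 = path_shift x n.
Proof. by rewrite /path_tile/= path_vertex_puncture add0r. Qed.

Lemma path_shift0 x : path_shift x 0%N = 0.
Proof. by rewrite /path_shift big_ord1 path_edge0. Qed.

Lemma path_tile_0 x n : support (path_tile x n).1 0.
Proof.
elim: n => [|n]; last exact: path_tileS.
by have [_ _] := path_tile_is_tile x 0%N; rewrite path_tile_puncture path_shift0.
Qed.

Definition near_origin n t := exists2 y, support t y & enorm y <= radius n.

(** This is X_n(x). Allowing every frame of every level [N] avoids a choice; by [level_tilingE] a
    single frame suffices near the origin. *)
Definition level_tiling x n : set tile :=
  [set t | exists N b,
    [/\ (n <= N)%N, is_frame x N b, near_origin N t & pshift b (T n) t]].

(** The origin belongs to P_N(x), so a tile within r_N of the origin is within r_N of P_N(x). *)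
Lemma frame_agree x n N b b' t : (n <= N)%N -> is_frame x N b -> is_frame x N b' ->
  near_origin N t -> pshift b (T n) t -> pshift b' (T n) t.
Proof.
move=> nN [SP PE] [S'P PE'] [y ty yN].
apply: (collared_near nN SP S'P); first by rewrite -PE -PE'.
by exists y, 0; rewrite sub0r enormN; split => //; exact: path_tile_0.
Qed.

Lemma level_tilingE x n N b t : (n <= N)%N -> is_frame x N b -> near_origin N t ->
  level_tiling x n t <-> pshift b (T n) t.
Proof.
move=> nN fb tN; split=> [[M [b' [nM fb' tM]]]|]; last by exists N, b.
have [NM|/ltnW MN] := leqP N M.
  exact: frame_agree nN (is_frame_le NM fb') fb tN.
exact: frame_agree nM fb' (is_frame_le MN fb) tM.
Qed.

End Nested.

(** * The tilings of a path *)
Section LevelTilings.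
Context {R : realType} {d : nat} {L : Type}.
Local Notation V := 'rV[R]_d.
Local Notation tile := (tile R d L).
Variable T : nat -> set tile.
Hypothesis HT : proper_nested T.
Local Notation boundary := (boundary T).
Implicit Types (t s u v w : tile) (a b z : V) (n m N M : nat) (x y : boundary).
Local Notation radius n := (min_inner_radius (T n)).
Local Notation near_origin := (near_origin T).

Lemma near_origin_ex t : is_tile t -> exists N0, forall N, (N0 <= N)%N -> near_origin N t.
Proof.
move=> /tile_support_neq0[z tz]; have [N0 HN] := radius_unbounded HT (enorm z).
by exists N0 => N /HN zN; exists z.
Qed.

Lemma level_tile_is_tile x n t : level_tiling x n t -> is_tile t.
Proof. by move=> [N [b [_ _ _]]]; exact: (tiling_tile (shifted_tiling HT b n)). Qed.

Lemma level_tiling_frames x n t : level_tiling x n t ->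
  exists N0, forall N b, (N0 <= N)%N -> is_frame x N b ->
    near_origin N t /\ pshift b (T n) t.
Proof.
move=> Xt; have [N0 HN] := near_origin_ex (level_tile_is_tile Xt).
exists (maxn n N0) => N b; rewrite geq_max => /andP[nN /HN tN] fb.
by split=> //; apply/(level_tilingE HT nN fb tN).
Qed.

(** Two tiles always lie in a common translate of the sequence, so pairwise properties of the T_n
    pass to the X_n(x). *)
Lemma level_tiling_in_frame2 x n m t s : level_tiling x n t -> level_tiling x m s ->
  exists b, pshift b (T n) t /\ pshift b (T m) s.
Proof.
move=> /level_tiling_frames[N HN] /level_tiling_frames[M HM].
have [b fb] := is_frame_ex x (maxn N M).
by exists b; split;
  [apply: (proj2 (HN _ _ (leq_maxl _ _) fb))|apply: (proj2 (HM _ _ (leq_maxr _ _) fb))].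
Qed.

Lemma tiling_level_tiling x n : tiling (level_tiling x n).
Proof.
have /choice[b fb] : forall N, exists b, is_frame x N b by exact: is_frame_ex.
split.
- apply: (@sub_countable _ _ _ (\bigcup_N pshift (b N) (T n))).
    apply: subset_card_le => t /level_tiling_frames[N0 HN].
    by exists N0 => //; exact: (proj2 (HN _ _ (leqnn _) (fb N0))).
  by apply: bigcup_countable => // N _; have [] := shifted_tiling HT (b N) n.
- exact: level_tile_is_tile.
- move=> t s Xt Xs; have [c [St Ss]] := level_tiling_in_frame2 Xt Xs.
  by have [_ _ + _] := shifted_tiling HT c n; apply.
- apply/seteqP; split => // z _.
  have [N0 HN] := radius_unbounded HT (enorm z).
  have [t St tz] := tiling_cover (shifted_tiling HT (b (maxn n N0)) n) z.
  exists t => //; exists (maxn n N0), (b (maxn n N0)); split=> //.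
    exact: leq_maxl.
  by exists z => //; apply: HN; exact: leq_maxr.
Qed.

Lemma level_puncture_eq x n t s : level_tiling x n t -> level_tiling x n s ->
  enorm (puncture t - puncture s) < radius n -> t = s.
Proof.
move=> Xt Xs; have [c [St Ss]] := level_tiling_in_frame2 Xt Xs.
rewrite -(min_inner_radius_pshift c (T n)).
exact: (puncture_separated (shifted_tiling HT c n) St Ss).
Qed.

Lemma near_origin_path_tile x n N : near_origin N (path_tile x n).1.
Proof.
exists 0; first exact: path_tile_0.
by rewrite enorm0 ltW// (proper_min_radius_gt0 HT).
Qed.

Lemma level_path_tile x n : level_tiling x n (path_tile x n).1.
Proof.
have [b fb] := is_frame_ex x n; exists n, b; split => //; last by case: fb.
exact: near_origin_path_tile.
Qed.

Lemma level_ancestor x n m t : (n <= m)%N -> level_tiling x n t ->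
  exists2 s, level_tiling x m s & support t `<=` support s.
Proof.
move=> nm Xt; have [N0 HN] := level_tiling_frames Xt.
have [b fb] := is_frame_ex x (maxn m N0).
have [[z tz zN] St] := HN _ _ (leq_maxr _ _) fb.
have [s Ss ts] := shifted_ancestor HT nm St; exists s => //.
exists (maxn m N0), b; split=> //; first exact: leq_maxl.
by exists z => //; exact: ts.
Qed.

Definition level_collar x n t : collared_tile R d L :=
  (t, [set w | level_tiling x n w /\ edist (support t) (support w) <= radius n]).

Lemma edist_bounded t w (k r : R) : is_tile t -> is_tile w ->
  (forall z, support t z -> enorm z <= k) ->
  edist (support t) (support w) <= r ->
  exists2 z, support w z & enorm z <= k + r + 1.
Proof.
move=> /tile_support_neq0 t0 /tile_support_neq0 w0 tk twr.
have [|z [z' [tz wz' zz']]] := edist_lt t0 w0 (_ : _ < r + 1).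
  by rewrite (le_lt_trans twr)// ltrDl.
exists z' => //; rewrite -(subrK z z') (le_trans (enormD _ _))//.
by have := tk _ tz; lra.
Qed.

Lemma level_collarE x n t : level_tiling x n t ->
  exists N0, forall N b, (N0 <= N)%N -> is_frame x N b ->
    pshift b (T n) t /\ collared (pshift b (T n)) t = level_collar x n t.
Proof.
move=> Xt; have [N0 HN] := level_tiling_frames Xt.
have t_tile := level_tile_is_tile Xt.
have [k k0 tk] : exists2 k : R, 0 < k & forall z, support t z -> enorm z <= k.
  by case: t_tile => /compact_enorm_bounded.
(* Every tile of the collar of [t] has a point of norm at most this bound, so from level [N1] on a
   frame shows the whole collar. *)
have [N1 HN1] := radius_unbounded HT (k + radius n + 1).
exists (maxn n (maxn N0 N1)) => N b.
rewrite !geq_max => /and3P[nN N0N /HN1 kN] fb.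
have [_ St] := HN _ _ N0N fb; split => //; congr pair.
have near w : is_tile w -> edist (support t) (support w) <= radius n -> near_origin N w.
  move=> w_tile /(edist_bounded t_tile w_tile tk)[z wz zk].
  by exists z => //; exact: le_trans zk kN.
apply/seteqP; split => w [Hw]; rewrite ?min_inner_radius_pshift => tw.
  split=> //; apply/(level_tilingE HT nN fb) => //.
  by apply: near tw; exact: (tiling_tile (shifted_tiling HT b n)).
split; last by rewrite min_inner_radius_pshift.
by apply/(level_tilingE HT nN fb) => //; apply: near tw; exact: level_tile_is_tile Hw.
Qed.

Lemma path_tileE x n : path_tile x n = level_collar x n (path_tile x n).1.
Proof.
have [N0 HN] := level_collarE (level_path_tile x n).
have [b fb] := is_frame_ex x (maxn n N0).
have [_ <-] := HN _ _ (leq_maxr _ _) fb.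
by have [] := is_frame_le HT (leq_maxl _ _) fb.
Qed.

(** * Equivalence of paths as translation of their tilings *)

Definition translates x y a :=
  forall n, level_tiling y n = pshift a (level_tiling x n).

(** A tile and its translate are both near the origin at high levels, where the two frames read
    X_n(x) and X_n(y) off translates of T_n that differ by [a]. *)
Lemma frames_translates x y a :
  (forall N0, exists N b, [/\ (N0 <= N)%N, is_frame x N b & is_frame y N (b + a)]) ->
  translates x y a.
Proof.
move=> H n.
have E t : is_tile t -> level_tiling y n t <-> level_tiling x n (tshift (- a) t).
  move=> t_tile; have [N0 HN] := near_origin_ex t_tile.
  have [N1 HN1] := near_origin_ex (is_tile_tshift (- a) t_tile).
  have [N [b []]] := H (maxn n (maxn N0 N1)).
  rewrite !geq_max => /and3P[nN /HN tN /HN1 atN] fx fy.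
  rewrite (level_tilingE HT nN fx atN) (level_tilingE HT nN fy tN).
  by rewrite !pshiftE tshiftD opprD [- a - b]addrC.
apply/seteqP; split=> t Xt; first by apply/pshiftE/E => //; exact: level_tile_is_tile Xt.
move/pshiftE : Xt => Xt; apply/E => //.
by rewrite -(tshiftNK a t); apply: is_tile_tshift; exact: level_tile_is_tile Xt.
Qed.

Lemma equiv_translates x y : boundary_equiv x y -> exists a, translates x y a.
Proof.
move=> [n0 [h [hor comm]]].
(* The commutative diagrams say exactly that this quantity is constant from [n0] on; it is the
   translation vector. *)
pose A n := path_shift y n - path_shift x n - elab (h n).
have AE n : (n0 <= n)%N -> A n = A n0.
  move=> /subnKC <-; elim: (n - n0)%N => [|k <-]; first by rewrite addn0.
  have [|_ _ _ _] := comm (n0 + k).+1; first by rewrite ltnS leq_addr.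
  rewrite addnS /= /A !path_shiftS => /(canRL (addKr _)) ->.
  by rewrite !opprD opprK; apply/rowP => i; rewrite !mxE; ring.
exists (A n0); apply: frames_translates => N0.
set n := maxn n0 N0; have n0n : (n0 <= n)%N := leq_maxl _ _.
have [c [c' [al [al' [t [t' [_ [[Tt ct] [Tt' ct']] _ hE]]]]]]] := hor _ n0n.
have [] := comm n.+1; first by rewrite ltnS.
rewrite /= hE !path_edgeS /= => -[cE] [c'E] _ _ _.
(* The horizontal edge finds the two vertices in T_n, translated by [al] and [al']. Moving them to
   P_n(x) and P_n(y) gives frames of [x] and [y] that differ by [A n]. *)
exists n, (- al + path_shift x n).
have frame x1 c1 al1 t1 : c1 = path_vertex x1 n -> T n t1 ->
    cshift al1 c1 = collared (T n) t1 -> is_frame x1 n (- al1 + path_shift x1 n).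
  move=> c1E Tt1 ct1.
  have PE : path_tile x1 n = collared (pshift (- al1 + path_shift x1 n) (T n))
      (tshift (- al1 + path_shift x1 n) t1).
    by rewrite collared_tshift -cshiftD -ct1 cshiftK c1E.
  by rewrite /is_frame PE; split=> //; exists t1.
split; [exact: leq_maxr|exact: frame cE Tt ct|].
rewrite -(AE _ n0n) /A hE /=.
rewrite [X in is_frame _ _ X](_ : _ = - al' + path_shift y n).
  exact: frame c'E Tt' ct'.
by apply/rowP => i; rewrite !mxE; ring.
Qed.

Lemma translates_sym x y a : translates x y a -> translates y x (- a).
Proof. by move=> H n; rewrite H pshiftK. Qed.

Lemma translates_trans x y (z : boundary) a b : translates x y a -> translates y z b ->
  translates x z (a + b).
Proof. by move=> H1 H2 n; rewrite H2 H1 pshiftD. Qed.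

Lemma level_collar_translates x y a n t : translates x y a ->
  level_collar y n (tshift a t) = cshift a (level_collar x n t).
Proof.
move=> H; congr pair; apply/seteqP; split => w.
  move=> [Yw tw]; apply/pshiftE; move: Yw; rewrite H => /pshiftE Xw; split => //.
  by rewrite -(edist_tshift a) tshiftNK.
by move=> [v [Xv tv] <-]; rewrite H; split; [exists v|rewrite edist_tshift].
Qed.

Lemma translates_equiv x y a : translates x y a -> boundary_equiv x y.
Proof.
move=> H; have [n0 Hn0] := radius_unbounded HT (enorm a).
(* This label makes all diagrams commute; what remains is that the two tiles occur in T_n in each
   other's collar. *)
exists n0, (fun n => Edge (Some (path_vertex x n)) (Some (path_vertex y n))
  (path_shift y n - path_shift x n - a)); split=> [n n0n|[//|n] _]; last first.
  rewrite !path_edgeS; split=> //=; apply/rowP => i; rewrite !mxE; ring.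
have Xy : level_tiling x n (tshift (- a) (path_tile y n).1).
  by apply/pshiftE; rewrite -H; exact: level_path_tile.
have [N0 HN] := level_collarE (level_path_tile x n).
have [N1 HN1] := level_collarE Xy.
have [b fb] := is_frame_ex x (maxn N0 N1).
have [/pshiftE Sx Cx] := HN _ _ (leq_maxl _ _) fb.
have [/pshiftE Sy Cy] := HN1 _ _ (leq_maxr _ _) fb.
have tT : T n = pshift (- b) (pshift b (T n)) by rewrite pshiftK.
(* The origin lies in P_n(x) and -a lies in P_n(y) - a, so the distance is at most |a| <= r_n. *)
have dist_le : edist (support (path_tile x n).1)
    (support (tshift (- a) (path_tile y n).1)) <= radius n.
  apply: le_trans (Hn0 _ n0n); rewrite -enormN.
  have y0 : support (tshift (- a) (path_tile y n).1) (- a).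
    by rewrite support_tshift/= subrr; exact: path_tile_0.
  by have := edist_le (path_tile_0 HT x n) y0; rewrite subr0.
exists (path_vertex x n), (path_vertex y n), (path_shift x n - b),
  (path_shift y n - a - b), (tshift (- b) (path_tile x n).1),
  (tshift (- b) (tshift (- a) (path_tile y n).1)); split.
- by split; [case: (path_vertexP x n)|case: (path_vertexP y n)].
- split; (split; first by []); rewrite tT collared_tshift.
    by rewrite Cx -path_tileE /path_tile cshiftD.
  rewrite Cy (level_collar_translates _ _ (translates_sym H)) -path_tileE.
  by rewrite /path_tile !cshiftD addrA.
- by split; split => //; rewrite edist_tshift// edistC.
- by congr Edge; apply/rowP => i; rewrite !mxE; ring.
Qed.

(** The path is read off its tilings: P_0 is the tile of X_0 with puncture 0, and P_{n+1} is the
    tile of X_{n+1} containing P_n. The ball of radius [K] is large enough to meet all the collars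
    involved. *)
Lemma path_tile_close y N : exists K : R, forall y',
  (forall n t, (n <= N)%N -> (exists2 z, support t z & enorm z <= K) ->
    level_tiling y n t <-> level_tiling y' n t) ->
  forall n, (n <= N)%N -> path_tile y n = path_tile y' n.
Proof.
have sub n : (n <= N)%N -> support (path_tile y n).1 `<=` support (path_tile y N).1.
  move=> /subnKC <-; elim: (N - n)%N => [|k IH]; first by rewrite addn0.
  by rewrite addnS; move=> z /IH; exact: path_tileS.
have [k k0 tk] : exists2 k : R, 0 < k &
    forall z, support (path_tile y N).1 z -> enorm z <= k.
  by case: (path_tile_is_tile HT y N) => /compact_enorm_bounded.
have rN0 := proper_min_radius_gt0 HT N.
exists (k + radius N + 1) => y' H.
have K0 n (y1 : boundary) : exists2 z, support (path_tile y1 n).1 z & enorm z <= k + radius N + 1.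
  by exists 0; [exact: path_tile_0|rewrite enorm0; lra].
have collarE n : (n <= N)%N -> (path_tile y n).1 = (path_tile y' n).1 ->
    path_tile y n = path_tile y' n.
  move=> nN PE; rewrite path_tileE [RHS]path_tileE -PE; congr pair.
  have near w : is_tile w ->
      edist (support (path_tile y n).1) (support w) <= radius n ->
      exists2 z, support w z & enorm z <= k + radius N + 1.
    move=> w_tile yw; apply: (edist_bounded (path_tile_is_tile HT y n) w_tile).
      by move=> z /(sub _ nN)/tk.
    by apply: le_trans yw _; exact: radius_le.
  by apply/seteqP; split => w [Xw yw]; split => //; apply/(H _ _ nN) => //;
    apply: near yw; exact: level_tile_is_tile Xw.
elim=> [|n IH] nN; apply: collarE => //.
  apply: (@level_puncture_eq y' 0%N); [|exact: level_path_tile|].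
    by apply/(H _ _ nN) => //; exact: level_path_tile.
  rewrite !path_tile_puncture !path_shift0 subrr enorm0.
  exact: (proper_min_radius_gt0 HT).
have [z yz] := tile_interior_neq0 (path_tile_is_tile HT y n).
apply: (tiling_eq (tiling_level_tiling y' n.+1) (y := z)).
- by apply/(H _ _ nN) => //; exact: level_path_tile.
- exact: level_path_tile.
- by apply: filterS yz; exact: path_tileS.
- by move: yz; rewrite (IH (ltnW nN)); apply: filterS; exact: path_tileS.
Qed.

Lemma path_tile_edges x y N :
  (forall n, (n <= N)%N -> path_tile x n = path_tile y n) ->
  forall n, (n <= N)%N -> path_edge x n = path_edge y n.
Proof.
move=> H.
have shiftE n : (n <= N)%N -> path_shift x n = path_shift y n.
  by move=> nN; rewrite -!path_tile_puncture H.
have vertexE n : (n <= N)%N -> path_vertex x n = path_vertex y n.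
  move=> nN; rewrite -(cshiftK (path_shift x n) (path_vertex x n)).
  by rewrite -/(path_tile x n) H// /path_tile shiftE// cshiftK.
case=> [|n] nN; first by rewrite !path_edge0 vertexE.
by rewrite !path_edgeS !vertexE ?(ltnW nN)// !shiftE ?(ltnW nN).
Qed.

Lemma edges_path_tile x y N :
  (forall n, (n <= N)%N -> path_edge x n = path_edge y n) ->
  forall n, (n <= N)%N -> path_tile x n = path_tile y n.
Proof.
move=> H n nN; rewrite /path_tile; congr cshift.
  by apply: eq_bigr => i _; rewrite H// (leq_trans _ nN)// -ltnS.
have [_ xE] := path_vertexP x n; have [_ yE] := path_vertexP y n.
by apply: Some_inj; rewrite -xE -yE H.
Qed.

(** Being a frame at level [N] depends only on P_N, so paths with a common prefix have a common
    frame. *)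
Lemma level_tiling_agree x y N n t :
  (forall m, (m <= N)%N -> path_edge x m = path_edge y m) ->
  (n <= N)%N -> near_origin N t -> level_tiling x n t <-> level_tiling y n t.
Proof.
move=> H nN tN; have [b fx] := is_frame_ex x N.
have fy : is_frame y N b by rewrite /is_frame -(edges_path_tile H).
by rewrite (level_tilingE HT nN fx tN) (level_tilingE HT nN fy tN).
Qed.

(** The path [y] goes through the successive ancestors [tt n] of [t], each with its collar in
    X_n(x), after moving the puncture of [t] to 0. *)
Lemma translates_ex x t : level_tiling x 0%N t ->
  exists y, translates x y (- puncture t).
Proof.
move=> Xt; set a := - puncture t.
have /choice[p Hp] : forall ns : nat * tile, exists u, level_tiling x ns.1 ns.2 ->
    level_tiling x ns.1.+1 u /\ support ns.2 `<=` support u.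
  move=> [n s] /=.
  have [/(level_ancestor (leqnSn n))[u Xu su]|Xs] := pselect (level_tiling x n s).
    by exists u.
  by exists s.
pose tt := fix tt n := if n is m.+1 then p (m, tt m) else t.
have Xtt n : level_tiling x n (tt n).
  by elim: n => //= n IH; have [] := Hp (n, tt n) IH.
have ttS n : support (tt n) `<=` support (tt n.+1).
  by have [] := Hp (n, tt n) (Xtt n).
(* The position of the n-th ancestor after this move; it turns out to be [path_shift y n]. *)
pose u n := puncture (tt n) + a.
pose c n := cshift (- puncture (tt n)) (level_collar x n (tt n)).
pose e n := Edge (if n is m.+1 then Some (c m) else None) (Some (c n))
  (if n is m.+1 then u n - u m else 0).
have cP n : prototiles (T n) (c n).
  have [N0 HN] := level_collarE (Xtt n); have [b fb] := is_frame_ex x N0.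
  have [[v Tv vE] Cv] := HN _ _ (leqnn _) fb; exists v => //.
  rewrite /c -Cv -vE collared_tshift cshiftD; congr cshift.
  by apply/rowP => i; rewrite !mxE; ring.
have eP : paths T e.
  move=> [|n]; split => //; first by exists (c 0%N).
  have [N0 HN] := level_collarE (Xtt n).
  have [N1 HN1] := level_collarE (Xtt n.+1).
  have [b fb] := is_frame_ex x (maxn N0 N1).
  have [Sv Cv] := HN _ _ (leq_maxl _ _) fb.
  have [Sw Cw] := HN1 _ _ (leq_maxr _ _) fb.
  have [v Tv vE] := Sv; have [w Tw wE] := Sw.
  exists (c n), (c n.+1), (u n - u n.+1); split => //; last first.
    by rewrite opprB.
  exists w, (b - puncture (tt n.+1)), v; split => //.
  - by rewrite /c -Cw -wE collared_tshift cshiftD.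
  - rewrite -(tshift0 w); apply/(substE HT) => //; rewrite pshift0 tshift0.
    split=> //; have := @ttS n; rewrite -vE -wE !support_tshift => vw z vz.
    by have := vw (z + b); rewrite /= !addrK; apply.
  - rewrite /c -Cv -vE collared_tshift !cshiftD; congr cshift.
    by rewrite /u -vE; apply/rowP => i; rewrite !mxE; ring.
pose y : boundary := SigSub (mem_set eP); exists y.
have shiftE n : path_shift y n = u n.
  elim: n => [|n IH]; first by rewrite path_shift0 /u /a subrr.
  by rewrite path_shiftS IH /path_edge /= addrC subrK.
have vertexE n : path_vertex y n = c n.
  by have [_] := path_vertexP y n; rewrite /path_edge /= => -[].
have tileE n : path_tile y n = cshift a (level_collar x n (tt n)).
  by rewrite /path_tile shiftE vertexE /c cshiftD /u addrA addNr add0r.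
(* A frame of [x] that shows [tt N] with its collar becomes a frame of [y] when shifted by [a]. *)
apply: frames_translates => N.
have [N0 HN] := level_collarE (Xtt N).
have [b fb] := is_frame_ex x (maxn N N0); exists N, b.
have [Sv Cv] := HN _ _ (leq_maxr _ _) fb.
split=> //; first exact: is_frame_le (leq_maxl _ _) fb.
rewrite /is_frame tileE -pshiftD -[(cshift _ _).1]/(tshift a (tt N)) collared_tshift Cv.
by split=> //; apply/pshift_tshift.
Qed.

End LevelTilings.

(** * Finiteness and aperiodicity *)
Lemma coord_le_enorm (R : realType) (d : nat) (v : 'rV[R]_d) i : `|v ord0 i| <= enorm v.
Proof.
rewrite -(@ler_pXn2r _ 2%N) ?nnegrE ?enorm_ge0// real_normK ?num_real// sqr_enorm.
by rewrite (bigD1 i)//= lerDl sumr_ge0// => j _; exact: sqr_ge0.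
Qed.

(** Two points in one cell of the cubic grid of side r / (d + 1) are at distance less than r, so [A]
    injects into the finitely many cells of a bounding cube. *)
Lemma separated_finite (R : realType) (d : nat) (A : set 'rV[R]_d) (r K : R) :
  0 < r -> (forall v, A v -> enorm v <= K) ->
  (forall v w, A v -> A w -> enorm (v - w) < r -> v = w) -> finite_set A.
Proof.
move=> r0 AK sepA; pose e := r / d.+1%:R.
have e0 : 0 < e by rewrite divr_gt0.
pose key (v : 'rV[R]_d) (i : 'I_d) := Num.trunc ((v ord0 i + K) / e).
pose M := Num.trunc ((K + K) / e).
have key_ge0 v i : A v -> 0 <= (v ord0 i + K) / e.
  move=> /AK vK; rewrite divr_ge0 ?(ltW e0)//.
  by have := le_trans (coord_le_enorm v i) vK; rewrite ler_norml; lra.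
have keyM v i : A v -> (key v i <= M)%N.
  move=> Av; apply: le_truncn; rewrite ler_pM2r ?invr_gt0//.
  by have := le_trans (coord_le_enorm v i) (AK _ Av); rewrite ler_norml; lra.
pose f (v : 'rV[R]_d) : {ffun 'I_d -> 'I_M.+1} := [ffun i => inord (key v i)].
suff finj : {in A &, injective f}.
  by rewrite -(eq_finite_set (inj_card_eq finj)).
move=> v w; rewrite !inE => Av Aw /ffunP fvw; apply: sepA => //.
have key_eq i : key v i = key w i.
  have /(congr1 val) := fvw i; rewrite !ffunE /=.
  by rewrite !inordK ?ltnS ?keyM.
apply: (le_lt_trans (enorm_le_norm _)).
apply: (@le_lt_trans _ _ (d%:R * e)).
  rewrite ler_wpM2l// [leLHS]/Num.norm/= mx_normrE.
  apply: bigmax_le => [|[i j] _]; first exact: ltW.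
  rewrite /= ord1 !mxE.
  have /andP[v1 v2] := truncn_itv (key_ge0 v j Av).
  have /andP[w1 w2] := truncn_itv (key_ge0 w j Aw).
  have kvw := key_eq j; rewrite /key in kvw; rewrite kvw -natr1 in v1 v2.
  rewrite -natr1 in w2.
  set k := (Num.trunc _)%:R in v1 v2 w1 w2.
  rewrite ler_pdivlMr// in v1; rewrite ltr_pdivrMr// in v2.
  rewrite ler_pdivlMr// in w1; rewrite ltr_pdivrMr// in w2.
  by rewrite ler_norml; lra.
by rewrite /e mulrCA gtr_pMr// ltr_pdivrMr// mul1r ltr_nat.
Qed.

Section Finiteness.
Context {R : realType} {d : nat} {L : Type}.
Local Notation V := 'rV[R]_d.
Local Notation tile := (tile R d L).
Variable T : nat -> set tile.
Hypothesis HT : proper_nested T.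
Local Notation boundary := (boundary T).
Implicit Types (t s u v w : tile) (a b z : V) (n m N M : nat) (x y : boundary).
Local Notation radius n := (min_inner_radius (T n)).
Local Notation near_origin := (near_origin T).

Lemma support_bounded n t : T n t ->
  support t `<=` eclosed_ball (puncture t) (max_outer_radius (T n) + 1).
Proof.
move=> Tt; have [ct _ pt] := tiling_tile (nested_tilingP HT n) Tt.
have [_ ub] := proper_max_radius HT n.
(* The extra 1 makes the inequality strict, which yields a containing ball of radius below the
   bound. *)
have : tile_outer_radius t < max_outer_radius (T n) + 1.
  rewrite (@le_lt_trans _ _ (max_outer_radius (T n)))// ?ltrDl//.
  by apply: ub_le_sup => //; exists t.
move=> /inf_lt[|rho [rho0 tr] rhoR z /tr]; last first.
  by rewrite /eclosed_ball/= => /le_trans; apply; exact: ltW.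
have [K K0 tK] := compact_enorm_bounded ct.
exists (K + K); split; first by rewrite addr_ge0// ltW.
move=> z tz; rewrite /eclosed_ball/= (le_trans (enormD _ _))// enormN.
by rewrite lerD ?tK.
Qed.

Lemma finite_near n (K : R) :
  finite_set [set t | T n t /\ exists2 z, support t z & enorm z <= K].
Proof.
set A := [set t | _].
have finj : {in A &, injective (@puncture R d L)}.
  move=> t s; rewrite !inE => -[Tt _] [Ts _] ts.
  apply: (puncture_separated (nested_tilingP HT n) Tt Ts).
  by rewrite ts subrr enorm0 (proper_min_radius_gt0 HT).
rewrite -(eq_finite_set (inj_card_eq finj)).
apply: (@separated_finite _ _ _ (radius n) (max_outer_radius (T n) + 1 + K)).
- exact: (proper_min_radius_gt0 HT).
- move=> _ [t [Tt [z tz zK]] <-]; rewrite -(subrK z (puncture t)).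
  rewrite (le_trans (enormD _ _))// lerD// enormBC.
  exact: (support_bounded Tt tz).
- move=> _ _ [t [Tt _] <-] [s [Ts _] <-] ts.
  by rewrite (puncture_separated (nested_tilingP HT n) Tt Ts ts).
Qed.

Lemma finite_collar n t : T n t -> finite_set (collar (T n) t).
Proof.
move=> Tt; have t_tile := tiling_tile (nested_tilingP HT n) Tt.
have [k k0 tk] : exists2 k : R, 0 < k & forall z, support t z -> enorm z <= k.
  by case: t_tile => /compact_enorm_bounded.
apply: sub_finite_set (finite_near n (k + radius n + 1)) => w [Tw tw].
split => //; apply: (edist_bounded t_tile _ tk tw).
exact: (tiling_tile (nested_tilingP HT n) Tw).
Qed.

Lemma sub_patch_of n p : finite_set p -> p `<=` T n -> patch_of (T n) p.
Proof.
move=> pfin pT; split => //; split=> // [t /pT|t s /pT Tt /pT Ts].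
  exact: (tiling_tile (nested_tilingP HT n)).
by have [_ _ + _] := nested_tilingP HT n; apply.
Qed.

Lemma collar_mem n t : T n t -> collar (T n) t t.
Proof.
move=> Tt; split=> //; have [_ _ pt] := tiling_tile (nested_tilingP HT n) Tt.
rewrite (le_trans (edist_le pt pt))// subrr enorm0 ltW//.
exact: (proper_min_radius_gt0 HT).
Qed.

Lemma collar_outer_radius n : exists2 K : R, 0 < K & forall t, T n t ->
  outer_radius (puncture t) (psupport (collar (T n) t)) < K.
Proof.
set k := max_outer_radius (T n) + 1.
have r0 := proper_min_radius_gt0 HT n.
have [t0 Tt0 _] := tiling_cover (nested_tilingP HT n) 0.
have k0 : 0 <= k.
  have [_ _ pt] := tiling_tile (nested_tilingP HT n) Tt0.
  by have := support_bounded Tt0 pt; rewrite /eclosed_ball/= subrr enorm0.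
(* From the puncture of [t] to a point of [t], across to a point of [w], to the puncture of [w], to
   [y]: three steps of length at most k and one below r_n + 1. The last 1 makes the bound strict. *)
exists (k + k + k + radius n + 1 + 1); first by lra.
move=> t Tt; apply: (@le_lt_trans _ _ (k + k + k + radius n + 1)); last by lra.
apply: ge_inf; first by exists 0 => rho [].
split; first by lra.
move=> y [w [Tw tw] wy].
have t_tile := tiling_tile (nested_tilingP HT n) Tt.
have w_tile := tiling_tile (nested_tilingP HT n) Tw.
have [|z [z' [tz wz' zz']]] := edist_lt (tile_support_neq0 t_tile)
  (tile_support_neq0 w_tile) (_ : _ < radius n + 1).
  by rewrite (le_lt_trans tw)// ltrDl.
have := support_bounded Tw wy; have := support_bounded Tw wz'.
have := support_bounded Tt tz; rewrite -/k /eclosed_ball/= => h1 h2 h3.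
have := enorm_triangle (puncture w) y (puncture t).
have := enorm_triangle z' (puncture w) (puncture t).
have := enorm_triangle z z' (puncture t).
by rewrite (enormBC (puncture w) z'); lra.
Qed.

(** Collars have bounded outer radius, so FLC leaves finitely many of them up to translation, and
    each has finitely many tiles to serve as centre. *)
Lemma finite_prototiles n : finite_set (prototiles (T n)).
Proof.
have [K K0 HK] := collar_outer_radius n; have [F Ffin HF] := proper_FLC HT n K0.
apply: (@sub_finite_set _ _ (\bigcup_(q in F `&` [set q | finite_set q])
    [set cshift (- puncture t) (t, q) | t in q])); last first.
  apply: bigcup_finite => [|q [_ qfin]]; first exact: finite_setIl.
  exact: finite_image.
move=> _ [t Tt <-]; have colT := sub_patch_of (finite_collar Tt) (fun w => @proj1 _ _).
have [q [a [Fq qE]]] := HF _ _ colT (collar_mem Tt) (HK _ Tt).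
exists q; first split => //.
  have := finite_collar Tt; rewrite qE => pfin /=.
  by rewrite -(pshiftK a q); exact: finite_image.
have /pshiftE qt : pshift a q t by rewrite -qE; exact: collar_mem.
exists (tshift (- a) t) => //; rewrite /collared qE.
rewrite -[(tshift _ t, q)](_ : cshift (- a) (t, pshift a q) = _).
  by rewrite cshiftD; congr cshift; apply/rowP => i; rewrite !mxE; ring.
by rewrite /cshift/= pshiftK.
Qed.

(** Many tiles of [T n.+1] may represent [c]. By [collared_sub] their collared subtiles all come
    from the finite patch below one fixed representative [s]. *)
Lemma finite_collared_subst n c : prototiles (T n.+1) c ->
  finite_set (collared_subst (T n) (T n.+1) c).
Proof.
move=> [s Ts cE].
have [[sfin _ _] _] := proper_subst_patch HT Ts.
apply: sub_finite_set (finite_image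
  (fun v => cshift (- puncture s) (collared (T n) v)) sfin).
move=> _ [s' [b [v [Ts' cE' sv ->]]]].
have [Tv vs] : T n v /\ support v `<=` support s'.
  by rewrite -(pshift0 (T n)) -(tshift0 s') -(substE HT)// tshift0.
have [S1 S2] : tshift b s' = tshift (- puncture s) s /\
    collared (pshift b (T n.+1)) (tshift b s') =
    collared (pshift (- puncture s) (T n.+1)) (tshift b s').
  have E1 : tshift b s' = tshift (- puncture s) s.
    by move: (congr1 fst cE'); rewrite -cE.
  by split => //; rewrite {2}E1 !collared_tshift cE -cE'.
have [||||Sv Cv] := @collared_sub _ _ _ _ HT n n.+1 b (- puncture s) (tshift b s')
    (tshift b v) (leqnn _) _ _ S2.
- by exists s'.
- by rewrite S1; exists s.
- by exists v.
- by rewrite !support_tshift => y /vs.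
exists (tshift (puncture s) (tshift b v)).
  rewrite -(tshift0 s); apply/(substE HT) => //; rewrite pshift0 tshift0.
  split; first by move/pshiftE : Sv; rewrite opprK.
  have : support (tshift b v) `<=` support (tshift (- puncture s) s).
    by rewrite -S1 !support_tshift => y /vs.
  move=> H; rewrite support_tshift => y /= /H; rewrite support_tshift/=.
  by rewrite opprK subrK.
by rewrite -!collared_tshift tshiftK Cv.
Qed.

Lemma finite_edges n : finite_set (edges T n).
Proof.
case: n => [|n]; first exact: finite_image (finite_prototiles 0).
apply: (@sub_finite_set _ _ (\bigcup_(c' in prototiles (T n.+1))
  [set Edge (Some (cshift (- puncture u.1) u)) (Some c') (- puncture u.1)
    | u in collared_subst (T n) (T n.+1) c'])); last first.
  apply: bigcup_finite => [|c' Tc']; first exact: finite_prototiles.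
  by apply: finite_image; exact: finite_collared_subst.
move=> _ [c [c' [a [[t Tt cE] Tc' Hu ->]]]]; exists c' => //.
exists (cshift a c) => //.
have -> : puncture (cshift a c).1 = a by rewrite -cE /= subrr add0r.
by rewrite cshiftK.
Qed.

(** * Identification of the tiling T_x with X_0(x) *)

Lemma desubstE n b p : p `<=` pshift b (T n) ->
  desubst T n p = [set t | pshift b (T 0%N) t /\ exists2 w, p w & support t `<=` support w].
Proof.
elim: n p => [|n IH] p pT /=.
  apply/seteqP; split=> [t pt|t [Tt [w pw tw]]]; first by split; [exact: pT|exists t].
  by rewrite (tiling_sub_eq (shifted_tiling HT b 0) Tt (pT _ pw) tw).
have substP : subst_patch (T n) (T n.+1) p =
    [set u | pshift b (T n) u /\ exists2 w, p w & support u `<=` support w].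
  apply/seteqP; split=> [u [w pw]|u [Tu [w pw uw]]].
    have [s Ts sE] := pT _ pw; rewrite -sE => /(substE HT _ _ Ts)[Tu us].
    by split => //; exists w; rewrite // -sE.
  exists w => //; have [s Ts sE] := pT _ pw; rewrite -sE.
  by apply/(substE HT) => //; split=> //; rewrite sE.
rewrite substP IH; last by move=> u [].
apply/seteqP; split=> t [Tt [w]].
  by move=> [_ [w' pw' ww']] tw; split => //; exists w' => //; exact: subset_trans tw ww'.
(* The intermediate tile is the ancestor [u] of [t] at level n; the parent of [u] shares interior
   points with [w], hence is [w]. *)
move=> pw tw; split => //; have [u Tu tu] := shifted_ancestor HT (leq0n n) Tt.
exists u => //; split=> //; exists w => //.
have [s Ts us] := shifted_ancestor HT (leqnSn n) Tu.
have [y ty] := tile_interior_neq0 (tiling_tile (shifted_tiling HT b 0) Tt).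
rewrite (tiling_eq (shifted_tiling HT b n.+1) (pT _ pw) Ts (y := y))//.
  by apply: filterS ty.
by apply: filterS ty => z /tu/us.
Qed.

Lemma collared_patchE x n b : is_frame x n b -> collared_patch x n =
  [set t | pshift b (T 0%N) t /\
    exists2 w, (path_tile x n).2 w & support t `<=` support w].
Proof.
move=> [_ PE]; rewrite /collared_patch; have [_ ->] := path_vertexP x n.
rewrite -/(path_shift x n) /vertex_collar.
have vE : (path_vertex x n).2 = pshift (- path_shift x n) (path_tile x n).2.
  by rewrite /path_tile /= pshiftK.
have vT : (path_vertex x n).2 `<=` pshift (b - path_shift x n) (T n).
  rewrite vE PE => _ [w [Sw _] <-]; rewrite -pshiftD; exact/pshift_tshift.
rewrite (desubstE vT) vE; apply/seteqP; split=> t.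
  move=> /pshiftE[]; rewrite -pshiftD => /pshift_tshift St [_ [w Pw <-]] tw.
  split=> //; exists w => // z tz.
  have := tw (z - path_shift x n); rewrite !support_tshift/= opprK subrK.
  exact.
move=> [St [w Pw tw]]; apply/pshiftE; split.
  by rewrite -pshiftD; apply/pshift_tshift.
exists (tshift (- path_shift x n) w); first by exists w.
by rewrite !support_tshift => z /tw.
Qed.

(** A tile of the patch lies inside some [w] of the collar of P_n(x). As [w] belongs to X_n(x), a
    frame of high level contains it, together with the tiles nested in it. *)
Lemma collared_patch_sub x n : collared_patch x n `<=` level_tiling x 0%N.
Proof.
have [b fb] := is_frame_ex x n; rewrite (collared_patchE fb) => t [St [w]].
move: (fb) => [_ PE].
move=> Pw tw; have Sw : pshift b (T n) w by move: Pw; rewrite PE => -[].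
have Xw : level_tiling x n w by move: Pw; rewrite (path_tileE HT) => -[].
have [N0 HN] := level_tiling_frames HT Xw.
have [N1 HN1] := near_origin_ex HT (tiling_tile (shifted_tiling HT b 0) St).
have [b' fb'] := is_frame_ex x (maxn N0 N1); exists (maxn N0 N1), b'; split=> //.
  by apply: HN1; exact: leq_maxr.
have [_ S'w] := HN _ _ (leq_maxl _ _) fb'.
exact: (shifted_nest HT (leq0n n) Sw S'w).
Qed.

(** The ancestor at level [N] of a tile within r_N of the origin is within r_N of P_N(x), hence in
    its collar. *)
Lemma level_tiling_sub x : level_tiling x 0%N `<=` \bigcup_n collared_patch x n.
Proof.
move=> t /(level_tiling_frames HT)[N HN]; have [b fb] := is_frame_ex x N.
have [[y ty yN] St] := HN _ _ (leqnn _) fb; exists N => //.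
rewrite (collared_patchE fb); split=> //.
have [w Sw tw] := shifted_ancestor HT (leq0n N) St; exists w => //.
case: fb => _ ->; split=> //; rewrite min_inner_radius_pshift (le_trans _ yN)//.
by have := edist_le (path_tile_0 HT x N) (tw _ ty); rewrite subr0.
Qed.

Lemma level_tiling_transversal x : transversal (T 0%N) (level_tiling x 0%N).
Proof.
split; last first.
  exists (path_tile x 0%N).1; first exact: level_path_tile.
  by rewrite path_tile_puncture path_shift0.
split; first exact: tiling_level_tiling.
(* Once r_N >= 1/e, a frame of level N gives a translate of T_0 agreeing with X_0(x) on the
   punctures in B(0, 1/e). *)
move=> eps eps0; pose e := Num.min eps 1 / 2.
have [e0 e1 eeps] : [/\ 0 < e, e < 1 & e < eps].
  by rewrite /e; have [?|?] := leP eps 1; split; lra.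
have [N HN] := radius_unbounded HT e^-1; have [b fb] := is_frame_ex x N.
exists b; apply: le_lt_trans eeps; apply: ge_inf.
  by exists 0 => r [[/andP[/ltW]]|->].
left; split; first by rewrite e0.
exists 0, 0; rewrite /eball/= subrr enorm0; split => // t; rewrite !pshift0 subr0 => te.
have near : is_tile t -> near_origin N t.
  move=> [_ _ pt]; exists (puncture t) => //; apply: le_trans (ltW te) _.
  exact: HN.
have E := level_tilingE HT (leq0n N) fb.
split=> Ht; first by apply/E => //; apply/near/(tiling_tile (shifted_tiling HT b 0) Ht).
by apply/E => //; exact/near/(level_tile_is_tile HT Ht).
Qed.

Lemma path_tilingE x : path_tiling x = level_tiling x 0%N.
Proof.
apply: xget_unique => [n|S HS].
  by split; [exact: level_tiling_transversal|exact: collared_patch_sub].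
apply/esym/tiling_subset_eq; first exact: tiling_level_tiling.
  by have [[[]]] := HS 0%N.
by move=> t /level_tiling_sub[n _]; have [_] := HS n; apply.
Qed.

(* A copy in [level_tiling x 0] of the tiles of [T 0] around [tshift a t]
   contains the translate by [a] of the copy of [t]; hence [T 0] itself is
   invariant by [a]. *)
Lemma level_tiling_aperiodic x a :
  pshift a (level_tiling x 0%N) = level_tiling x 0%N -> a = 0.
Proof.
move=> Xa; apply/eqP/negPn/negP => a0; apply: (proper_aperiodic HT (n := 0%N) a0).
apply: tiling_subset_eq; [exact: shifted_tiling|exact: nested_tilingP|].
move=> _ [t Tt <-]; have tT := nested_tilingP HT 0.
have ta_tile := is_tile_tshift a (tiling_tile tT Tt).
have [K K0 tK] : exists2 K : R, 0 < K &
    forall z, support (tshift a t) z -> enorm z <= K.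
  by case: ta_tile => /compact_enorm_bounded.
pose p := t |` [set w | T 0%N w /\ exists2 z, support w z & enorm z <= K].
have pT : p `<=` T 0%N by move=> w [->|[]].
have pfin : finite_set p by rewrite finite_setU; split; [exact: finite_set1|exact: finite_near].
have [rho rho0 Hrho] := proper_repetitive HT (sub_patch_of pfin pT).
have [N HN] := radius_unbounded HT rho; have [b fb] := is_frame_ex x N.
have [c [cT cb]] := Hrho (- b).
have pX w : p w -> level_tiling x 0%N (tshift (c + b) w).
  move=> pw; exists N, b; split => //.
    have [_ _ pw'] := tiling_tile tT (pT _ pw).
    exists (puncture w + (c + b)).
      by rewrite support_tshift/= addrK.
    have := cb (puncture w + c); rewrite /eball/= opprK addrA => wc.
    rewrite (le_trans (ltW (wc _)) (HN _ (leqnn _)))//.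
    by exists (tshift c w); [exists w|rewrite support_tshift/= addrK].
  by rewrite -tshiftD; apply/pshift_tshift/cT; exists w.
have [y ty] := tile_interior_neq0 ta_tile.
have [w Tw wy] := tiling_cover tT y.
have pw : p w by right; split => //; exists y => //; apply: tK; exact: interior_subset.
have Xta : level_tiling x 0%N (tshift (c + b) (tshift a t)).
  rewrite -Xa; apply/pshiftE; rewrite !tshiftD [X in tshift X _](_ : _ = c + b).
    by apply: pX; left.
  by rewrite addrCA subrr addr0.
have /(congr1 (tshift (- (c + b)))) :
    tshift (c + b) (tshift a t) = tshift (c + b) w.
  apply: (tiling_meet_eq (tiling_level_tiling HT x 0) Xta (pX _ pw) (y := y + (c + b))).
    by rewrite interior_tshift/= addrK.
  by rewrite support_tshift/= addrK.
by rewrite !tshiftK => ->.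
Qed.

Lemma translates_uniq x y a b : translates x y a -> translates x y b -> a = b.
Proof.
move=> Ha Hb; have := translates_trans Ha (translates_sym Hb) 0%N.
by move=> /esym/level_tiling_aperiodic/subr0_eq.
Qed.

(** By aperiodicity of X_0(x) only one vector satisfies the condition inside [xget]. *)
Lemma translation_vectorE x y a : translates x y a -> translation_vector x y = a.
Proof.
move=> H; apply: xget_unique; first by rewrite !path_tilingE; exact: H.
move=> b; rewrite !path_tilingE (H 0%N) => E.
apply/esym/subr0_eq/(@level_tiling_aperiodic x).
by rewrite -pshiftD E pshiftK.
Qed.

Lemma translates_translation_vector x y : boundary_equiv x y ->
  translates x y (translation_vector x y).
Proof. by move=> /(equiv_translates HT)[a H]; rewrite (translation_vectorE H). Qed.

End Finiteness.

(** * The path space *)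
Section PathSpace.
Context {R : realType} {d : nat} {L : Type}.
Variable T : nat -> set (tile R d L).
Local Notation boundary := (boundary T).
Implicit Types (x y z : boundary) (n N M : nat).

Definition same_prefix N x : set boundary :=
  [set y | forall n, (n <= N)%N -> path_edge x n = path_edge y n].

Lemma boundary_ext x y : (forall n, path_edge x n = path_edge y n) -> x = y.
Proof. by move=> xy; apply: val_inj; apply/functional_extensionality_dep => n; exact: xy. Qed.

Lemma path_coord_nbhs (f : prod_topology (fun _ : nat => discrete_topology (edge R d L))) n :
  nbhs f [set g | g n = f n].
Proof.
exact: (@proj_continuous _ (fun _ : nat => discrete_topology (edge R d L)) n f _
  (@discrete_set1 (discrete_topology (edge R d L)) (f n))).
Qed.

Lemma path_edge_nbhs x n : nbhs x [set y | path_edge x n = path_edge y n].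
Proof.
have H : nbhs x ((fun y : boundary => val y) @^-1` [set f | f n = val x n]).
  exact: (@initial_continuous (set_type (paths T)) _ set_val x _
    (path_coord_nbhs (val x) n)).
by apply: filterS H => y /esym.
Qed.

Lemma nbhs_boundaryP x (A : set boundary) :
  nbhs x A <-> exists N, same_prefix N x `<=` A.
Proof.
split=> [[_ [[Q oQ <-] Qx] QA]|[N NA]]; last first.
  apply: filterS NA _; elim: N => [|N IH].
    apply: filterS (path_edge_nbhs x 0%N) => y xy n.
    by rewrite leqn0 => /eqP->.
  apply: filterS2 IH (path_edge_nbhs x N.+1) => y H xy n.
  by rewrite leq_eqVlt => /predU1P[->|/H].
(* The filter generated by the cylinders around [x] converges to [x] coordinatewise, hence in the
   product; so an open set around [x] contains a cylinder. *)
pose F : set_system (prod_topology (fun _ : nat => discrete_topology (edge R d L))) :=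
  filter_from setT (fun N => [set f | forall n, (n <= N)%N -> val x n = f n]).
have FF : Filter F.
  apply: filter_from_filter; first by exists 0%N.
  move=> i j _ _; exists (maxn i j) => // f fx; split=> n nN; apply: fx.
    exact: leq_trans nN (leq_maxl _ _).
  exact: leq_trans nN (leq_maxr _ _).
have Fx : F --> val x.
  apply/cvg_sup => i U [/= _ [[W /= oW <-] /= Wx]] WU; rewrite nbhs_filterE.
  by exists i => // f fx; apply: WU => /=; rewrite -[f i]fx.
have [N _ NQ] := Fx _ (open_nbhs_nbhs (conj oQ Qx)).
by exists N => y xy; apply/QA/NQ => n /xy.
Qed.

Lemma nbhs_same_prefix N x : nbhs x (same_prefix N x).
Proof. by apply/nbhs_boundaryP; exists N. Qed.

Lemma closed_paths : closed (paths T).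
Proof.
move=> f cf n.
have nf : nbhs f ([set g | g n = f n] `&` [set g | g n.+1 = f n.+1]).
  by apply: filterI; exact: path_coord_nbhs.
have [g [gT [gn gSn]]] := cf _ nf.
by have := gT n; rewrite gn gSn.
Qed.

Lemma compact_boundary : (forall n, finite_set (edges T n)) -> compact [set: boundary].
Proof.
move=> Efin.
have cprod : compact [set f : prod_topology (fun _ : nat => discrete_topology (edge R d L)) |
    forall n, edges T n (f n)].
  by apply: tychonoff => n; exact: finite_compact.
have cpaths : compact (paths T).
  by apply: subclosed_compact cprod _; [exact: closed_paths|move=> f fT n; have [] := fT n].
move=> F FF _; have FT : F (fun x => paths T (val x)).
  by apply: filterS filterT => x _; exact: (set_valP x).
have [//|f [fT Ff]] := cpaths (val @ F).
exists (SigSub (mem_set fT)); split=> // A B FA [_ [[Q oQ <-] Qf] QB].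
have FvA : F (fun x => [set val y | y in A] (val x)).
  by apply: filterS FA => x Ax; exists x.
have [|g [[x Ax <-] Qx]] := Ff [set val y | y in A] Q FvA; first exact: open_nbhs_nbhs.
by exists x; split => //; exact: QB.
Qed.

Definition first_diff_inv (P : pred nat) : R :=
  if pselect (exists n, P n) is left e then (ex_minn e).+1%:R^-1 else 0.

Lemma first_diff_inv_ge0 P : 0 <= first_diff_inv P.
Proof. by rewrite /first_diff_inv; case: pselect => // e; rewrite invr_ge0. Qed.

Lemma first_diff_inv_ge (P : pred nat) n : P n -> n.+1%:R^-1 <= first_diff_inv P.
Proof.
move=> Pn; rewrite /first_diff_inv; case: pselect => [e|[]]; last by exists n.
case: ex_minnP => m _ /(_ _ Pn) mn.
by rewrite lef_pV2 ?posrE// ler_nat ltnS.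
Qed.

Lemma first_diff_inv_lt (P : pred nat) N : (forall n, (n <= N)%N -> ~~ P n) ->
  first_diff_inv P < N.+1%:R^-1.
Proof.
move=> H; rewrite /first_diff_inv; case: pselect => [e|_]; last by rewrite invr_gt0.
case: ex_minnP => m Pm _; rewrite ltf_pV2 ?posrE// ltr_nat ltnS ltnNge.
by apply/negP => /H; rewrite Pm.
Qed.

Lemma first_diff_inv_le (P Q1 Q2 : pred nat) : (forall n, P n -> Q1 n || Q2 n) ->
  first_diff_inv P <= first_diff_inv Q1 + first_diff_inv Q2.
Proof.
move=> H; rewrite {1}/first_diff_inv; case: pselect => [e|_]; last first.
  by rewrite addr_ge0 ?first_diff_inv_ge0.
case: ex_minnP => m /H /orP[]/first_diff_inv_ge/le_trans mQ _; apply: mQ.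
  by rewrite lerDl first_diff_inv_ge0.
by rewrite lerDr first_diff_inv_ge0.
Qed.

Lemma metrizable_boundary : metrizable R boundary.
Proof.
pose m x y := first_diff_inv (fun n => path_edge x n != path_edge y n).
have mP N x y : m x y < N.+1%:R^-1 <-> same_prefix N x y.
  split=> [mN n nN|xy]; last first.
    by apply: first_diff_inv_lt => n /xy ->; rewrite eqxx.
  apply/eqP/negPn/negP => /(@first_diff_inv_ge (fun n => path_edge x n != path_edge y n)).
  rewrite leNgt (lt_le_trans mN)// lef_pV2 ?posrE// ler_nat ltnS//.
exists m; split.
- by move=> x y; exact: first_diff_inv_ge0.
- move=> x y; split=> [m0|->].
    by apply: boundary_ext => n; apply: (proj1 (mP n x y)) => //; rewrite m0 invr_gt0.
  apply/le_anti; rewrite first_diff_inv_ge0 andbT.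
  rewrite /m /first_diff_inv; case: pselect => // e.
  by case: ex_minnP => k; rewrite eqxx.
- by move=> x y; congr first_diff_inv; apply/funext => n; rewrite eq_sym.
- move=> x y z; apply: first_diff_inv_le => n; rewrite -negb_and.
  by apply: contra => /andP[/eqP-> /eqP->].
- move=> x A; rewrite nbhs_boundaryP; split=> [[N NA]|[e e0 eA]].
    by exists N.+1%:R^-1; rewrite ?invr_gt0// => y /mP/NA.
  exists (Num.bound e^-1) => y /mP xy; apply: eA; apply: lt_le_trans xy _.
  rewrite -[leRHS]invrK lef_pV2 ?posrE ?invr_gt0//.
  have e1 : 0 <= e^-1 by rewrite invr_ge0 ltW.
  by rewrite (le_trans (ltW (archi_boundP e1)))// ler_nat.
Qed.

End PathSpace.

(** * The relation as a set of pairs (path, vector) *)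
Section Groupoid.
Context {R : realType} {d : nat} {L : Type}.
Variable T : nat -> set (tile R d L).
Hypothesis HT : proper_nested T.
Local Notation V := 'rV[R]_d.
Local Notation boundary := (boundary T).
Local Notation groupoid := (boundary_relation T).
Local Notation pr := (boundary_relation_val (T := T)).
Implicit Types (x y z : boundary) (n N M : nat) (g h : groupoid) (a : V).
Local Notation radius n := (min_inner_radius (T n)).

Definition displacement g : V := translation_vector (pr g).1 (pr g).2.

Lemma displacementP g : translates (pr g).1 (pr g).2 (displacement g).
Proof. by apply: translates_translation_vector => //; have := set_valP g. Qed.

Lemma translates0_eq x y : translates x y 0 -> x = y.
Proof.
move=> xy; apply: boundary_ext => n; have [K HK] := path_tile_close HT x n.
apply: (path_tile_edges (N := n)) (leqnn n); apply: HK => m t mn _.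
by rewrite xy pshift0.
Qed.

Lemma translates_eq x y z a : translates x y a -> translates x z a -> y = z.
Proof.
move=> xy xz; apply: translates0_eq.
by rewrite -(addNr a); exact: translates_trans (translates_sym xy) xz.
Qed.

Lemma relation_ex x y a : translates x y a ->
  exists2 g, pr g = (x, y) & displacement g = a.
Proof.
move=> xy; have Exy : boundary_graph (x, y) by exact: translates_equiv xy.
by exists (SigSub (mem_set Exy)); rewrite // /displacement (translation_vectorE HT xy).
Qed.

Lemma relation_ext g h : (pr g).1 = (pr h).1 -> displacement g = displacement h -> g = h.
Proof.
move=> gh1 gh2; apply: val_inj; rewrite -[val g]/(pr g) -[val h]/(pr h).
rewrite [pr g]surjective_pairing [pr h]surjective_pairing gh1; congr pair.
apply: translates_eq (displacementP h).
by rewrite -gh1 -gh2; exact: displacementP.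
Qed.

Lemma origin_preimage x y a : translates x y a ->
  level_tiling x 0%N (tshift (- a) (path_tile y 0%N).1) /\
  puncture (tshift (- a) (path_tile y 0%N).1) = - a.
Proof.
move=> xy; split; last first.
  by rewrite [LHS](_ : _ = puncture (path_tile y 0%N).1 - a)//
    path_tile_puncture path_shift0 add0r.
by apply/pshiftE; rewrite -xy; exact: level_path_tile.
Qed.

Lemma near_origin_puncture N t : is_tile t -> enorm (puncture t) <= radius N ->
  near_origin T N t.
Proof. by move=> [_ _ pt] tN; exists (puncture t). Qed.

Lemma translates_locally_constant M x y x' y' a a' :
  translates x y a -> translates x' y' a' -> same_prefix M x x' ->
  enorm (a' - a) < radius 0 -> enorm a + radius 0 <= radius M -> a' = a.
Proof.
move=> xy xy' xx' aa' aM.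
have [Xt tp] := origin_preimage xy; have [Xt' tp'] := origin_preimage xy'.
have {}Xt' : level_tiling x 0%N (tshift (- a') (path_tile y' 0%N).1).
  apply/(level_tiling_agree HT xx') => //; apply: near_origin_puncture.
    exact: level_tile_is_tile Xt'.
  rewrite tp' enormN -(subrK a a') (le_trans (enormD _ _))//.
  by rewrite (le_trans _ aM)// addrC lerD2l ltW.
apply: oppr_inj; rewrite -tp -tp'; congr puncture.
by apply/esym/(level_puncture_eq HT Xt Xt'); rewrite tp tp' opprK addrC.
Qed.

Lemma translates_prefix x y a N : translates x y a -> exists M,
  forall x' y', translates x' y' a -> same_prefix M x x' -> same_prefix N y y'.
Proof.
move=> xy; have [K HK] := path_tile_close HT y N.
have [M0 HM] := radius_unbounded HT (K + enorm a).
exists (maxn N M0) => x' y' xy' xx'; apply: path_tile_edges; apply: HK.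
move=> n t nN [z tz zK]; rewrite xy xy' !pshiftE.
apply: (level_tiling_agree HT xx'); first exact: leq_trans nN (leq_maxl _ _).
exists (z - a); first by rewrite support_tshift/= opprK subrK.
rewrite (le_trans (enormD _ _))// enormN.
by apply: le_trans (HM _ (leq_maxr _ _)); rewrite lerD2r.
Qed.

Lemma translates_extend x y a : translates x y a -> exists M,
  forall x', same_prefix M x x' -> exists y', translates x' y' a.
Proof.
move=> xy; have [M HM] := radius_unbounded HT (enorm a); exists M => x' xx'.
have [Xt tp] := origin_preimage xy; rewrite -[a]opprK -tp.
apply: (translates_ex HT); apply/(level_tiling_agree HT xx') => //.
apply: near_origin_puncture; first exact: level_tile_is_tile Xt.
by rewrite tp enormN HM.
Qed.

Definition relation_cylinder N g : set groupoid :=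
  [set h | same_prefix N (pr g).1 (pr h).1 /\ displacement h = displacement g].

Lemma nbhs_relationP g (A : set groupoid) :
  nbhs g A <-> exists N, relation_cylinder N g `<=` A.
Proof.
split=> [[_ [[U oU <-] Ug] UA]|[N NA]].
  have [[P Q] [/= /nbhs_boundaryP[N NP] Qa] PQ] := open_nbhs_nbhs (conj oU Ug).
  exists N => h [xh ah]; apply: UA; apply: PQ; split => /=; first exact: NP.
  by rewrite -[translation_vector _ _]/(displacement h) ah; exact: nbhs_singleton Qa.
have [M0 HM] := radius_unbounded HT (enorm (displacement g) + radius 0).
pose M := maxn N M0.
pose B := [set xa : boundary * V |
  same_prefix M (pr g).1 xa.1 /\ eball (displacement g) (radius 0) xa.2].
have nB : nbhs ((pr g).1, displacement g) B.
  exists (same_prefix M (pr g).1, eball (displacement g) (radius 0)) => //=.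
  split; first exact: nbhs_same_prefix.
  by apply: nbhs_eball; exact: (proper_min_radius_gt0 HT).
have nA : nbhs g ((fun h => ((pr h).1, displacement h)) @^-1` B).
  exact: (@initial_continuous _ _ (fun xy : set_type (boundary_graph (T := T)) =>
    ((val xy).1, translation_vector (val xy).1 (val xy).2)) g _ nB).
apply: filterS nA => h [/= xh ah]; apply: NA; split.
  by move=> n nN; apply: xh; rewrite (leq_trans nN)// leq_maxl.
apply: (translates_locally_constant (displacementP g) (displacementP h) xh ah).
by apply: HM; exact: leq_maxr.
Qed.

Lemma nbhs_cylinder N g : nbhs g (relation_cylinder N g).
Proof. by apply/nbhs_relationP; exists N. Qed.

Lemma relation_cvgP (S : Type) (F : set_system S) (FF : Filter F) (f : S -> groupoid) g :
  (forall N, F (f @^-1` relation_cylinder N g)) -> f @ F --> g.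
Proof.
move=> H A /nbhs_relationP[N NA]; apply: filterS (H N) => s /NA; exact.
Qed.

Lemma open_cylinder N g : open (relation_cylinder N g).
Proof.
rewrite openE => h [xh ah]; apply/nbhs_relationP; exists N => k [xk ak].
by split=> [n nN|]; rewrite ?ak// xh// xk.
Qed.

Lemma range_continuous : continuous (fun g => (pr g).1).
Proof.
move=> g A /nbhs_boundaryP[N NA].
by apply: filterS (nbhs_cylinder N g) => h [/NA].
Qed.

Lemma source_continuous : continuous (fun g => (pr g).2).
Proof.
move=> g A /nbhs_boundaryP[N NA].
have [M HM] := translates_prefix N (displacementP g).
apply: filterS (nbhs_cylinder M g) => h [xh ah]; apply: NA; apply: HM xh.
by rewrite -ah; exact: displacementP.
Qed.

Lemma range_open : open_map (fun g => (pr g).1).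
Proof.
move=> A; rewrite openE => oA; rewrite openE => _ [g /oA/nbhs_relationP[N NA] <-].
have [M HM] := translates_extend (displacementP g).
apply/nbhs_boundaryP; exists (maxn N M) => x xg.
have [|y xy] := HM x; first by move=> n nM; apply: xg; rewrite (leq_trans nM)// leq_maxr.
have [h hE ha] := relation_ex xy; exists h; last by rewrite hE.
apply: NA; split=> // n nN; rewrite hE; apply: xg.
by rewrite (leq_trans nN)// leq_maxl.
Qed.

Lemma range_local : local_homeomorphism (fun g => (pr g).1).
Proof.
move=> g; have [M HM] := translates_extend (displacementP g).
exists (relation_cylinder M g); split => //.
- exact: open_cylinder.
- by apply: range_open; exact: open_cylinder.
- by apply: continuous_subspaceT; exact: range_continuous.
have /choice[f fP] : forall x, exists h, same_prefix M (pr g).1 x ->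
    (pr h).1 = x /\ displacement h = displacement g.
  move=> x; have [xg|] := pselect (same_prefix M (pr g).1 x); last by exists g.
  by have [y xy] := HM _ xg; have [h hE ha] := relation_ex xy; exists h; rewrite hE.
exists f.
  move=> h [xh ah]; have [fx fa] := fP _ xh.
  by apply: relation_ext; rewrite ?fa.
apply/subspace_continuousP => x [h [xh _] hx].
have [fx fa] : (pr (f x)).1 = x /\ displacement (f x) = displacement g.
  by rewrite -hx; exact: fP.
apply: relation_cvgP => N; apply: filterS (nbhs_same_prefix N x) => y xy.
move=> [k [xk _] ky]; have [fy fb] : (pr (f y)).1 = y /\ displacement (f y) = displacement g.
  by rewrite -ky; exact: fP.
by split; rewrite ?fa ?fb// fx fy.
Qed.

Lemma inverse_ex : exists2 i : groupoid -> groupoid, involutive i &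
  continuous i /\ forall g, pr (i g) = ((pr g).2, (pr g).1).
Proof.
have /choice[i iP] : forall g, exists h,
    pr h = ((pr g).2, (pr g).1) /\ displacement h = - displacement g.
  move=> g; have [h hE ha] := relation_ex (translates_sym (displacementP g)).
  by exists h.
exists i.
  move=> g; have [E1 E2] := iP (i g); have [E3 E4] := iP g.
  by apply: relation_ext; rewrite ?E1 ?E2 ?E3 ?E4 //= opprK.
split=> [g A /nbhs_relationP[N NA]|g]; last by have [] := iP g.
have [M HM] := translates_prefix N (displacementP g).
apply: filterS (nbhs_cylinder M g) => h [xh ah]; apply: NA.
have [E1 E2] := iP h; have [E3 E4] := iP g.
split; last by rewrite E2 E4 ah.
rewrite E1 E3 /=; apply: HM xh.
by rewrite -ah; exact: displacementP.
Qed.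

Lemma source_open : open_map (fun g => (pr g).2).
Proof.
have [i iK [ci iE]] := inverse_ex => A oA.
rewrite [X in open X](_ : _ = (fun g => (pr g).1) @` (i @^-1` A)).
  by apply: range_open; apply: open_comp => // g _; exact: ci.
apply/seteqP; split=> _ [g Ag <-].
  by exists (i g); rewrite /= ?iK// iE.
by exists (i g); rewrite // iE.
Qed.

Lemma source_local : local_homeomorphism (fun g => (pr g).2).
Proof.
have [i iK [ci iE]] := inverse_ex => g.
have [U [oU Ug orU crU [f fK cf]]] := range_local (i g).
have sE : (fun h => (pr h).2) @` (i @^-1` U) = (fun h => (pr h).1) @` U.
  apply/seteqP; split=> _ [h Uh <-].
    by exists (i h); rewrite // iE.
  by exists (i h); rewrite /= ?iK// iE.
exists (i @^-1` U); split => //.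
- by apply: open_comp => // h _; exact: ci.
- by rewrite sE.
- by apply: continuous_subspaceT; exact: source_continuous.
exists (i \o f).
  by move=> h Uh /=; rewrite -{2}(iK h) -(fK (i h))// iE.
rewrite sE; apply: within_continuous_comp cf => h _; exact: ci.
Qed.

Lemma product_ex : exists2 m : groupoid * groupoid -> groupoid,
  forall gh, composable pr gh -> pr (m gh) = ((pr gh.1).1, (pr gh.2).2) &
  {within composable pr, continuous m}.
Proof.
have /choice[m mP] : forall gh : groupoid * groupoid, exists k, composable pr gh ->
    pr k = ((pr gh.1).1, (pr gh.2).2) /\
    displacement k = displacement gh.1 + displacement gh.2.
  move=> gh; have [ghE|] := pselect (composable pr gh); last by exists gh.1.
  have gh2 := displacementP gh.2; rewrite -ghE in gh2.
  have [k kE ka] := relation_ex (translates_trans (displacementP gh.1) gh2).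
  by exists k.
exists m; first by move=> gh /mP[].
apply/subspace_continuousP => gh ghE; have [E1 E2] := mP _ ghE.
apply: relation_cvgP => N.
have : nbhs gh [set gh' | relation_cylinder N gh.1 gh'.1 /\ relation_cylinder N gh.2 gh'.2].
  exists (relation_cylinder N gh.1, relation_cylinder N gh.2) => //.
  by split; exact: nbhs_cylinder.
apply: filterS => gh' [[x1 a1] [x2 a2]] ghE'; have [E3 E4] := mP _ ghE'.
by split; rewrite ?E1 ?E3// E4 E2 a1 a2.
Qed.

Lemma closed_composable : closed (composable pr).
Proof.
move=> gh cgh; apply: boundary_ext => n.
have : nbhs gh [set gh' | same_prefix n (pr gh.1).2 (pr gh'.1).2 /\
    relation_cylinder n gh.2 gh'.2].
  exists ((fun g => (pr g).2) @^-1` same_prefix n (pr gh.1).2, relation_cylinder n gh.2) => //.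
  split; last exact: nbhs_cylinder.
  by apply: source_continuous; exact: nbhs_same_prefix.
move=> /cgh[gh' [ghE [H1 [H2 _]]]].
by rewrite H1// ghE H2.
Qed.

Lemma open_diagonal : open [set g | (pr g).1 = (pr g).2].
Proof.
rewrite openE => g /= gE; apply/nbhs_relationP; exists 0%N => h [_ ah] /=.
apply: translates0_eq.
have <- : displacement h = 0; last exact: displacementP.
rewrite ah; apply: (translates_uniq HT (displacementP g)).
by rewrite -gE => n; rewrite pshift0.
Qed.

End Groupoid.

Theorem theorem3p21 (R : realType) (d : nat) (L : Type)
    (T : nat -> set (tile R d L)) :
  proper_nested T ->
  etale R (boundary_equiv (T := T)) (boundary_relation_val (T := T)).
Proof.
move=> HT; split.
- by move=> x; apply: (@translates_equiv _ _ _ _ HT _ _ 0) => n; rewrite pshift0.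
- move=> x y /(equiv_translates HT)[a xy].
  exact: translates_equiv (translates_sym xy).
- move=> x y z /(equiv_translates HT)[a xy] /(equiv_translates HT)[b yz].
  exact: translates_equiv (translates_trans xy yz).
- by apply: compact_boundary; exact: finite_edges.
- exact: metrizable_boundary.
- exact: val_inj.
- apply/seteqP; split=> [_ [g _ <-]|xy Exy]; first exact: (set_valP g).
  by exists (SigSub (mem_set (Exy : boundary_graph xy))).
- exact: closed_composable.
- by apply: continuous_subspaceT => gh; exact: cvg_fst.
- by apply: continuous_subspaceT => gh; exact: cvg_snd.
- exact: product_ex.
- exact: open_diagonal.
- exact: range_open.
- exact: range_local.
- exact: source_open.
- exact: source_local.
Qed.
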